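(* Let $x=(x^1,x^2)\in\mathbb{R}^2$, $\xi=(\xi^1,\dots,\xi^4)\in\mathbb{R}^4$, $u=(u_1,\dots,u_8)\in\mathbb{R}^8$ be coordinates on $\mathbb{R}^{14}$. Put $p=u_1u_3+u_2u_4$, $P=u_1\xi^3+u_4\xi^2$, $\bar P=u_3\xi^1+u_2\xi^4$, and consider the system of differential one-forms on $\mathbb{R}^{14}$ $$\begin{aligned} \omega_1&=du_1-\xi^1\,dx^1-p u_2\,dx^2=0,\\ \omega_2&=du_2+p u_1\,dx^1-\xi^2\,dx^2=0,\\ \omega_3&=du_3-p u_4\,dx^1-\xi^3\,dx^2=0,\\ \omega_4&=du_4-\xi^4\,dx^1+p u_3\,dx^2=0,\\ \omega_5&=du_5-[u_2\bar P-p^2u_1]\,dx^1-[u_2P+p\xi^2]\,dx^2=0,\\ \omega_6&=du_6+[u_1\bar P+p\xi^1]\,dx^1+[u_1P+p^2u_2]\,dx^2=0,\\ \omega_7&=du_7-[u_4\bar P+p\xi^4]\,dx^1-[u_4P-p^2u_3]\,dx^2=0,\\ \omega_8&=du_8+[u_3\bar P+p^2u_4]\,dx^1+[u_3P+p\xi^3]\,dx^2=0, \end{aligned}$$ with independent variables $x^1,x^2$ and unknown functions $u_s=u_s(x^1,x^2)$ $(s=1,\dots,8)$, $\xi^r=\xi^r(x^1,x^2)$ $(r=1,\dots,4)$. If this system is in involution at a regular point $(x_0,\xi_0,u_0)\in\mathbb{R}^{14}$ and is an analytic system in some neighbourhood of $(x_0,\xi_0,u_0)$, then the general analytic solution of the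 system with independent variables $x^1,x^2$ exists in some neighbourhood of the regular point $(x_0,\xi_0,u_0)$, and it depends on four arbitrary real analytic functions of one real variable.
   Context: The terms ''regular point'', ''in involution'', and ''general analytic solution depending on $k$ arbitrary functions of one variable'' are used in the standard sense of the Cartan (Cartan–Kähler) theory of exterior differential systems with independence condition $dx^1\wedge dx^2\neq 0$. Specifically, write $\omega_s=du_s-\sum_{\mu=1}^2 G_{s\mu}(x,\xi,u)\,dx^\mu$, $s=1,\dots,8$. The first Cartan character is $s_1=\max_{X\in\mathbb{R}^2}\operatorname{rank}\left(\sum_\mu \frac{\partial G_{s\mu}}{\partial \xi^r}X^\mu\right)_{s=1..8,\,r=1..4}$ at the point, the second is $s_2=4-s_1$ (where $4$ is the number of variables $\xi^r$), and the Cartan number is $Q=s_1+2s_2$. Let $N$ be the number of free parameters in the general solution of the polar equations $\langle\omega_s, Y_\mu\rangle=0$, $d\omega_s(Y_1,Y_2)=0$ $(s=1,\dots,8$, $\mu=1,2)$ for pairs of vectors $Y_1=\partial_{x^1}+\cdots$, $Y_2=\partial_{x^2}+\cdots$ at the point. The system is in involution at a regular point when $Q=N$ there. That the general analytic solution depends on $k$ arbitrary functions of one variable is meant in Cartan's sense: the last nonvanishing Cartan character is the first one and it equals $k$ (arbitrary constants are not counted). The system encodes the Weierstrass–Enneper system $\partial\psi_1=p\psi_2$, $\bar\partial\psi_2=-p\psi_1$, $\bar\partial\bar\psi_1=p\bar\psi_2$, $\partial\bar\psi_2=-p\bar\psi_1$, $p=|\psi_1|^2+|\psi_2|^2$, via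 $x=(\bar z,z)$, $\xi=(\bar\partial\psi_1,\partial\psi_2,\partial\bar\psi_1,\bar\partial\bar\psi_2)$, $u=(\psi_1,\psi_2,\bar\psi_1,\bar\psi_2,\partial\psi_1,\bar\partial\psi_2,\bar\partial\bar\psi_1,\partial\bar\psi_2)$, with all these quantities treated as independent real coordinates. *)

(* Defs.v *)
(* MathComp / MathComp-Analysis *)
From HB Require Import structures.
From mathcomp Require Import all_boot all_order all_algebra.
From mathcomp Require Import all_classical all_reals all_analysis.

Set Implicit Arguments.
Unset Strict Implicit.
Unset Printing Implicit Defensive.

Import Order.TTheory GRing.Theory Num.Theory.
Import numFieldNormedType.Exports.

Local Open Scope classical_set_scope.
Local Open Scope ring_scope.

Section Analytic.
Context {R : realType}.

(* A function of n real variables is analytic at a when it is the sum, on a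
   polydisc (a ball for the sup norm), of a power series in the n variables.
   The bound on the coefficients makes the series converge absolutely there,
   so summing over the boxes [0, N[^n loses nothing. *)
Definition analytic_at n (f : 'rV[R]_n -> R) (a : 'rV[R]_n) : Prop :=
  exists (rho M : R) (c : {ffun 'I_n -> nat} -> R),
    [/\ 0 < rho,
        forall k : {ffun 'I_n -> nat}, `|c k| * rho ^+ (\sum_i k i)%N <= M &
        forall x : 'rV[R]_n, `|x - a| < rho ->
          (fun N : nat => \sum_(k : {ffun 'I_n -> 'I_N})
              c [ffun i => k i : nat] * \prod_i ((x - a) 0 i) ^+ k i)
            @ \oo --> f x].

Definition analytic1_at (f : R -> R) (a : R) : Prop :=
  analytic_at (fun t : 'rV[R]_1 => f (t 0 0)) (const_mx a).

End Analytic.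

(* Systems omega_s = du_s - \sum_mu G_{s mu}(x, xi, u) dx^mu, s < q, in two
   independent variables x, with m variables xi and q variables u. *)
Section PfaffianSystems.
Context {R : realType} (m q : nat).

Definition graph_point (x : 'rV[R]_2) (xi : 'rV[R]_m) (u : 'rV[R]_q) :
  'rV[R]_(2 + m + q) := row_mx (row_mx x xi) u.

Definition xpart (z : 'rV[R]_(2 + m + q)) : 'rV[R]_2 := lsubmx (lsubmx z).
Definition xipart (z : 'rV[R]_(2 + m + q)) : 'rV[R]_m := rsubmx (lsubmx z).
Definition upart (z : 'rV[R]_(2 + m + q)) : 'rV[R]_q := rsubmx z.

Variable G : 'rV[R]_(2 + m + q) -> 'M[R]_(q, 2).

(* The value <omega_s, Y> at z. *)
Definition omega (s : 'I_q) (z Y : 'rV[R]_(2 + m + q)) : R :=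
  upart Y 0 s - \sum_mu G z s mu * xpart Y 0 mu.

(* The value d omega_s (Y1, Y2) at z, computed with the constant vector fields
   Y1, Y2, for which the bracket term vanishes. *)
Definition d_omega (s : 'I_q) (z Y1 Y2 : 'rV[R]_(2 + m + q)) : R :=
  'D_Y1 (fun w => omega s w Y2) z - 'D_Y2 (fun w => omega s w Y1) z.

(* The matrix \sum_mu (dG_{s mu} / dxi^r) X^mu. *)
Definition symbol (z : 'rV[R]_(2 + m + q)) (X : 'rV[R]_2) : 'M[R]_(q, m) :=
  \matrix_(s, r) \sum_mu
    'D_(graph_point 0 (delta_mx 0 r) 0) (fun w => G w s mu) z * X 0 mu.

(* First Cartan character: the largest rank of symbol z X over all X; the rank
   is at most m, so that the maximum may be taken over k <= m. *)
Definition char1 (z : 'rV[R]_(2 + m + q)) : nat :=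
  \max_(k < m.+1 | `[< exists X, \rank (symbol z X) = k >]) k.

Definition char2 (z : 'rV[R]_(2 + m + q)) : nat := (m - char1 z)%N.

Definition cartan_number (z : 'rV[R]_(2 + m + q)) : nat :=
  (char1 z + 2 * char2 z)%N.

(* The rows of Y are the two vectors Y_1, Y_2. *)
Definition polar_equations (z : 'rV[R]_(2 + m + q)) (Y : 'M[R]_(2, 2 + m + q)) :
    Prop :=
  [/\ forall mu, xpart (row mu Y) = delta_mx 0 mu,
      forall s mu, omega s z (row mu Y) = 0 &
      forall s, d_omega s z (row 0 Y) (row 1 Y) = 0].

(* The general solution of the polar equations at z is Y0 plus an arbitrary
   combination of N linearly independent matrices. *)
Definition polar_free_parameters (z : 'rV[R]_(2 + m + q)) (N : nat) : Prop :=
  exists (Y0 : 'M[R]_(2, 2 + m + q)) (B : 'M[R]_(N, 2 * (2 + m + q))),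
    row_free B /\
    forall Y, polar_equations z Y <-> (mxvec (Y - Y0) <= B)%MS.

Definition in_involution (z : 'rV[R]_(2 + m + q)) : Prop :=
  exists N, polar_free_parameters z N /\ cartan_number z = N.

(* The characters and the polar equations keep the same ranks near z.  (The
   forms omega_s themselves are everywhere linearly independent.) *)
Definition regular_point (z : 'rV[R]_(2 + m + q)) : Prop :=
  \forall w \near z, char1 w = char1 z /\
    forall N, polar_free_parameters w N <-> polar_free_parameters z N.

Definition analytic_near (z : 'rV[R]_(2 + m + q)) : Prop :=
  \forall w \near z, forall s mu, analytic_at (fun v => G v s mu) w.

(* Analytic functions xi, u defined near a whose graph is an integral surface:
   the pull-backs of the omega_s to the graph vanish. *)
Definition analytic_solution_at (a : 'rV[R]_2)
    (xi : 'rV[R]_2 -> 'rV[R]_m) (u : 'rV[R]_2 -> 'rV[R]_q) : Prop :=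
  let graph x := graph_point x (xi x) (u x) in
  \forall x \near a,
    [/\ forall r, analytic_at (fun y => xi y 0 r) x,
        forall s, analytic_at (fun y => u y 0 s) x &
        forall s (v : 'rV[R]_2), omega s (graph x) ('D_v graph x) = 0].

(* Solutions near a = xpart w with u(a) = upart w and prescribed values phi of
   the functions xi^r along the line through a directed by X.  These data are
   the same as an integral curve over that line: there, the u_s are obtained
   from the xi^r by integrating du_s = \sum_mu G_{s mu} dx^mu. *)
Definition solves_cauchy (w : 'rV[R]_(2 + m + q)) (X : 'rV[R]_2)
    (phi : 'I_m -> R -> R)
    (xi : 'rV[R]_2 -> 'rV[R]_m) (u : 'rV[R]_2 -> 'rV[R]_q) : Prop :=
  [/\ analytic_solution_at (xpart w) xi u,
      u (xpart w) = upart w &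
      \forall t \near (0 : R), forall r, xi (xpart w + t *: X) 0 r = phi r t].

(* Existence of the general analytic solution near z, in the sense of the
   Cartan-Kaehler theorem: every analytic integral curve starting near z along
   a non-characteristic direction lies on an analytic integral surface, which
   is unique (as a germ) when the second character vanishes. *)
Definition general_analytic_solution (z : 'rV[R]_(2 + m + q)) : Prop :=
  \forall w \near z, forall (X : 'rV[R]_2) (phi : 'I_m -> R -> R),
    X != 0 -> \rank (symbol w X) = char1 w ->
    (forall r, analytic1_at (phi r) 0) ->
    (forall r, phi r 0 = xipart w 0 r) ->
    (exists xi u, solves_cauchy w X phi xi u) /\
    (char2 w = 0%N -> forall xi u xi' u',
       solves_cauchy w X phi xi u -> solves_cauchy w X phi xi' u' ->
       \forall x \near xpart w, xi x = xi' x /\ u x = u' x).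

(* The general solution depends on k arbitrary functions of one variable: the
   last nonvanishing character is the first one, and it equals k. *)
Definition depends_on_functions_of_one_variable (z : 'rV[R]_(2 + m + q))
    (k : nat) : Prop :=
  [/\ char1 z <> 0%N, char2 z = 0%N & char1 z = k].

End PfaffianSystems.

(* G for the Weierstrass-Enneper system.  The local functions u and xi are
   numbered from 1. *)
Definition weierstrass {R : realType} (z : 'rV[R]_(2 + 4 + 8)) : 'M[R]_(8, 2) :=
  let u (k : nat) : R := upart z 0 (inord k.-1) in
  let xi (k : nat) : R := xipart z 0 (inord k.-1) in
  let p := u 1%N * u 3%N + u 2%N * u 4%N in
  let P := u 1%N * xi 3%N + u 4%N * xi 2%N in
  let Pbar := u 3%N * xi 1%N + u 2%N * xi 4%N in
  let rows : seq (R * R) :=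
    [:: (xi 1%N, p * u 2%N);
        (- (p * u 1%N), xi 2%N);
        (p * u 4%N, xi 3%N);
        (xi 4%N, - (p * u 3%N));
        (u 2%N * Pbar - p ^+ 2 * u 1%N, u 2%N * P + p * xi 2%N);
        (- (u 1%N * Pbar + p * xi 1%N), - (u 1%N * P + p ^+ 2 * u 2%N));
        (u 4%N * Pbar + p * xi 4%N, u 4%N * P - p ^+ 2 * u 3%N);
        (- (u 3%N * Pbar + p ^+ 2 * u 4%N), - (u 3%N * P + p * xi 3%N))] in
  \matrix_(s, mu) (if mu == 0 then (nth (0, 0) rows s).1
                   else (nth (0, 0) rows s).2).

(* Main.v *)
Require Import Defs.
From mathcomp Require Import all_boot all_order all_algebra.
From mathcomp Require Import all_classical all_reals all_analysis.
From mathcomp Require Import zify ring lra.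

(* The last four equations say that [u_5, ..., u_8] are [+- p u_k] up to constants, so the
   system is the semilinear system [d_2 u_1 = p u_2], [d_1 u_2 = - p u_1], [d_1 u_3 = p u_4],
   [d_2 u_4 = - p u_3], whose characteristics are the coordinate axes.  The symbol in the
   direction [X] has rank 4 when [X^1 X^2 <> 0] and is smaller otherwise; hence [s_1 = 4] and
   [s_2 = 0] at every point.

   Existence.  Integrating first along the given line and then along a characteristic turns
   the Cauchy problem into a fixed-point equation between formal power series whose right-hand
   side raises the degree, and involves no derivative.  The Picard iterates therefore stabilise
   degree by degree, and a weighted l^1 norm of their truncations stays bounded when the weight
   is small, so that the limit converges.

   Uniqueness.  On a small box the same integration, with the mean value theorem, divides by 2
   any bound on the difference of two solutions. *)

Set Implicit Arguments.
Unset Strict Implicit.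
Unset Printing Implicit Defensive.
Import Order.TTheory GRing.Theory Num.Theory.
Import numFieldNormedType.Exports.

(** The function xi^r is the first derivative of u_r that the first four equations leave free: d_1
    for r = 1, 4 and d_2 for r = 2, 3. Values of xi on a line are therefore what an integration
    needs. In each degree the prescribed derivative fixes all coefficients except that of the pure
    power of the other variable, and the line condition gives this one after division by a power of
    X^1 or X^2.

    These divisions may grow geometrically. Giving the two variables the weights rho |X^1| and rho
    |X^2| cancels them, and each integration then costs a factor proportional to rho. The right-hand
    side being cubic, a small rho keeps all iterates in one ball.

    In the uniqueness argument nothing is known about the two xi off the line. The path to a point
    therefore follows the line, where they agree, and then the direction in which the derivative of
    u_k is prescribed, where xi^k does not enter. *)

(** * Double series summed over square boxes *)

Section DoubleSums.
Local Open Scope classical_set_scope.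
Local Open Scope ring_scope.
Context {R : realType}.
Implicit Types (g h : nat -> nat -> R) (M th : R).

Definition box (N : nat) g : R := \sum_(i < N) \sum_(j < N) g i j.

Definition geom_dominated g M th := forall i j, `|g i j| <= M * th ^+ (i + j).

(** For 0 <= th < 1, the sum of th^(i+j) over all pairs outside the box of side [N]. *)
Definition tail th (N : nat) : R :=
  (1 - th)^-1 ^+ 2 - (\sum_(i < N) th ^+ i) ^+ 2.

Lemma boxD N g h : box N (fun i j => g i j + h i j) = box N g + box N h.
Proof.
by rewrite /box -big_split; apply: eq_bigr => i _; rewrite -big_split.
Qed.

Lemma boxZ N k g : box N (fun i j => k * g i j) = k * box N g.
Proof.
by rewrite /box mulr_sumr; apply: eq_bigr => i _; rewrite mulr_sumr.
Qed.

Lemma eq_box N g h :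
  (forall i j, (i < N)%N -> (j < N)%N -> g i j = h i j) -> box N g = box N h.
Proof. by move=> gh; apply: eq_bigr => i _; apply: eq_bigr => j _; apply: gh. Qed.

Lemma ler_box N g h :
  (forall i j, (i < N)%N -> (j < N)%N -> g i j <= h i j) -> box N g <= box N h.
Proof. by move=> gh; apply: ler_sum => i _; apply: ler_sum => j _; apply: gh. Qed.

Lemma box_ge0 N g : (forall i j, 0 <= g i j) -> 0 <= box N g.
Proof. by move=> g0; apply: sumr_ge0 => i _; apply: sumr_ge0. Qed.

Lemma ler_sum_widen (F : nat -> R) (N L : nat) : (N <= L)%N ->
  (forall i, 0 <= F i) -> \sum_(i < N) F i <= \sum_(i < L) F i.
Proof.
move=> NL F0; rewrite (big_ord_widen L F NL) [leRHS](bigID (fun i : 'I_L => (i < N)%N)) /=.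
by rewrite lerDl sumr_ge0.
Qed.

Lemma ler_box_widen N L g : (N <= L)%N -> (forall i j, 0 <= g i j) ->
  box N g <= box L g.
Proof.
move=> NL g0; apply: (@le_trans _ _ (\sum_(i < N) \sum_(j < L) g i j)).
  by apply: ler_sum => i _; apply: ler_sum_widen.
by apply: (@ler_sum_widen (fun i => \sum_(j < L) g i j)) => // i; apply: sumr_ge0.
Qed.

Lemma ler_norm_box N g : `|box N g| <= box N (fun i j => `|g i j|).
Proof.
apply: le_trans (ler_norm_sum _ _ _) _; apply: ler_sum => i _.
exact: ler_norm_sum.
Qed.

Lemma box_swap N g : box N (fun i j => g j i) = box N g.
Proof. by rewrite /box exchange_big. Qed.

Lemma ler_term_box N g i j : (forall i j, 0 <= g i j) -> (i < N)%N -> (j < N)%N ->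
  g i j <= box N g.
Proof.
move=> g0 iN jN; rewrite /box (bigD1 (Ordinal iN)) //= (bigD1 (Ordinal jN)) //=.
rewrite -addrA lerDl addr_ge0 ?sumr_ge0 // => k _; exact: sumr_ge0.
Qed.

Lemma box_geom N th : box N (fun i j => th ^+ (i + j)) = (\sum_(i < N) th ^+ i) ^+ 2.
Proof.
rewrite expr2 /box mulr_suml; apply: eq_bigr => i _; rewrite mulr_sumr.
by apply: eq_bigr => j _; rewrite exprD.
Qed.

Lemma cvg_geom_sum th : 0 <= th < 1 ->
  (fun N => \sum_(i < N) th ^+ i) @ \oo --> (1 - th)^-1.
Proof.
move=> /andP[th0 th1].
have := @cvg_geometric_series R 1 th; rewrite ger0_norm // mul1r => /(_ th1).
apply: cvg_trans; apply: near_eq_cvg; apply: nearW => N.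
by rewrite /series /= big_mkord; apply: eq_bigr => i _; rewrite mul1r.
Qed.

Lemma geom_sum_ge0 th N : 0 <= th -> 0 <= \sum_(i < N) th ^+ i.
Proof. by move=> th0; apply: sumr_ge0 => i _; rewrite exprn_ge0. Qed.

Lemma geom_sum_le th N : 0 <= th < 1 -> \sum_(i < N) th ^+ i <= (1 - th)^-1.
Proof.
move=> th01; have [th0 th1] := andP th01.
have cv := cvg_geom_sum th01.
have nd : nondecreasing_seq (fun N => \sum_(i < N) th ^+ i).
  by move=> m n mn; apply: (@ler_sum_widen (fun i => th ^+ i)) => // i; exact: exprn_ge0.
have := nondecreasing_cvgn_le nd (cvgP _ cv) N.
by rewrite (cvg_lim _ cv).
Qed.

Lemma cvg_tail th : 0 <= th < 1 -> tail th @ \oo --> 0.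
Proof.
move=> th01; rewrite -(subrr ((1 - th)^-1 ^+ 2)).
apply: cvgB; first exact: cvg_cst.
have cv := cvg_geom_sum th01.
by rewrite expr2; under eq_fun do rewrite expr2; apply: cvgM.
Qed.

Lemma tail_ge0 th N : 0 <= th < 1 -> 0 <= tail th N.
Proof.
move=> th01; have [th0 th1] := andP th01.
by rewrite subr_ge0 lerXn2r ?nnegrE ?geom_sum_ge0 ?geom_sum_le // invr_ge0; lra.
Qed.

Lemma geom_dominated_ge0 g M th : geom_dominated g M th -> 0 <= M.
Proof. by move=> /(_ 0%N 0%N); rewrite expr0 mulr1; apply: le_trans. Qed.

(* Both [M th^(i+j) + g] and [M th^(i+j) - g] are nonnegative, so that their box
   sums are nondecreasing. *)
Lemma box_diff g M th N L : 0 <= th < 1 -> geom_dominated g M th -> (N <= L)%N ->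
  `|box L g - box N g| <= M * tail th N.
Proof.
move=> th01 gM NL; have M0 := geom_dominated_ge0 gM.
have th0 : 0 <= th by case/andP: th01.
have H (s : R) : `|s| <= 1 -> s * (box L g - box N g) <= M * tail th N.
  move=> s1.
  have := @ler_box_widen N L (fun i j => M * th ^+ (i + j) + (- s) * g i j) NL.
  rewrite !boxD !boxZ !box_geom => /(_ _)/wrap[i j|].
    rewrite mulNr subr_ge0; apply: le_trans (ler_norm _) _; rewrite normrM.
    by apply: le_trans (gM i j); rewrite ler_piMl.
  have : M * (\sum_(i < L) th ^+ i) ^+ 2 <= M * (1 - th)^-1 ^+ 2.
    by rewrite ler_wpM2l// lerXn2r ?nnegrE ?geom_sum_ge0 ?geom_sum_le //
      (le_trans _ (geom_sum_le 0 th01)) ?geom_sum_ge0.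
  rewrite /tail; lra.
have := H 1; have := H (-1); rewrite normrN normr1 lexx => /(_ isT) A /(_ isT) B.
rewrite ler_norml; apply/andP; split; lra.
Qed.

Definition sums g (v : R) := (fun N => box N g) @ \oo --> v.

Lemma sums_unique g v w : sums g v -> sums g w -> v = w.
Proof. by move=> gv gw; rewrite -(cvg_lim _ gv) // -(cvg_lim _ gw). Qed.

Lemma eq_sums g h v : (forall i j, g i j = h i j) -> sums g v -> sums h v.
Proof. by move=> gh; suff -> : h = g by []; apply/funext => i; apply/funext => j. Qed.

Lemma sumsD g h v w : sums g v -> sums h w -> sums (fun i j => g i j + h i j) (v + w).
Proof. by move=> gv hw; rewrite /sums; under eq_fun do rewrite boxD; apply: cvgD. Qed.

Lemma sumsZ k g v : sums g v -> sums (fun i j => k * g i j) (k * v).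
Proof.
by move=> gv; rewrite /sums; under eq_fun do rewrite boxZ; apply: cvgM => //; exact: cvg_cst.
Qed.

Arguments sumsZ : clear implicits.

Lemma sums_approx (u w : nat -> R) (e : nat -> R) (v : R) :
  (forall N, `|u N - w N| <= e N) -> e @ \oo --> 0 -> u @ \oo --> v -> w @ \oo --> v.
Proof.
move=> uwe e0 uv; have -> : w = u - (u - w) by apply/funext => N; rewrite !fctE subKr.
rewrite -[v]subr0; apply: cvgB => //.
apply/norm_cvg0P; apply: (squeeze_cvgr _ (cvg_cst (0 : R)) e0).
by apply: nearW => N; rewrite normr_ge0 /=; apply: uwe.
Qed.

(** Adding the majorant makes the terms nonnegative, so that the box sums are nondecreasing and
    bounded; the sum of the majorant is known and is subtracted afterwards. *)
Lemma sums_ex g M th : 0 <= th < 1 -> geom_dominated g M th -> exists v, sums g v.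
Proof.
move=> th01 gM; have th0 : 0 <= th by case/andP: th01.
have M0 := geom_dominated_ge0 gM.
pose h i j := M * th ^+ (i + j) + g i j.
have h0 i j : 0 <= h i j.
  by rewrite /h -lerBlDr sub0r; apply: le_trans (gM i j); rewrite -normrN ler_norm.
have cgeo : sums (fun i j => th ^+ (i + j)) ((1 - th)^-1 * (1 - th)^-1).
  rewrite /sums; under eq_fun do rewrite box_geom expr2.
  by apply: cvgM; apply: cvg_geom_sum.
have : cvgn (fun N => box N h).
  apply: nondecreasing_is_cvgn.
    by move=> m n mn; apply: ler_box_widen.
  exists (M * (1 - th)^-1 ^+ 2 + (M * (1 - th)^-1 ^+ 2)) => _ [N _ <-].
  rewrite boxD boxZ; have B : M * box N (fun i j => th ^+ (i + j)) <= M * (1 - th)^-1 ^+ 2.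
    by rewrite box_geom ler_wpM2l // -subr_ge0 tail_ge0.
  apply: lerD => //; apply: le_trans B; apply: le_trans (ler_norm _) _.
  by rewrite -boxZ; apply: le_trans (ler_norm_box _ _) _; apply: ler_box => i j _ _; apply: gM.
move=> /cvg_ex[/= v hv]; exists (v + (- M) * ((1 - th)^-1 * (1 - th)^-1)).
have /(sumsD (sumsZ (- M) _ _ cgeo)) : sums h v by [].
by rewrite addrC; apply: eq_sums => i j; rewrite /h mulNr addKr.
Qed.

Lemma sums_bound g M th v N : 0 <= th < 1 -> geom_dominated g M th -> sums g v ->
  `|v - box N g| <= M * tail th N.
Proof.
move=> th01 gM gv.
have cv : (fun L => `|box L g - box N g|) @ \oo --> `|v - box N g|.
  by apply: cvg_norm; apply: cvgB => //; apply: cvg_cst.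
rewrite -(cvg_lim _ cv) //; apply: limr_le; first exact: cvgP cv.
near=> L; apply: box_diff => //; near: L; exact: nbhs_infty_ge.
Unshelve. all: by end_near. Qed.

Lemma cvg_tailM M th : 0 <= th < 1 -> (fun N => M * tail th N) @ \oo --> 0.
Proof. by move=> th01; rewrite -(mulr0 M); apply: cvgM; [exact: cvg_cst | exact: cvg_tail]. Qed.

(* Tannery's theorem, with truncations [e N] of [g] that agree with [g] on [0, N[^2. *)
Lemma tannery g (e : nat -> nat -> nat -> R) (L : nat -> nat) M th v :
  0 <= th < 1 -> (forall N, geom_dominated (e N) M th) -> (forall N, (N <= L N)%N) ->
  (forall N i j, (i < N)%N -> (j < N)%N -> e N i j = g i j) ->
  sums g v <-> (fun N => box (L N) (e N)) @ \oo --> v.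
Proof.
move=> th01 eM NL eg.
have D N : `|box (L N) (e N) - box N g| <= M * tail th N.
  by rewrite -(@eq_box N (e N) g) => [|i j iN jN]; [apply: box_diff | apply: eg].
split.
  apply: sums_approx (cvg_tailM M th01) => N; rewrite distrC; exact: D.
exact: sums_approx (cvg_tailM M th01).
Qed.

Lemma big_triangle g N :
  \sum_(n < N) \sum_(a < n.+1) g a (n - a)%N = \sum_(a < N) \sum_(k < N - a) g a k.
Proof.
transitivity (\sum_(n < N) \sum_(a < N | (a < n.+1)%N) g a (n - a)%N).
  by apply: eq_bigr => n _; rewrite (big_ord_widen N (fun a => g a (n - a)%N)).
rewrite (exchange_big_dep xpredT) //=; apply: eq_bigr => a _.
rewrite (eq_bigl (fun n : 'I_N => (a <= n)%N)) //.
rewrite -(big_mkord (fun n => (a <= n)%N) (fun n => g a (n - a)%N)).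
rewrite -(big_mkord xpredT (fun k => g a k)) -{1}[nat_of_ord a]add0n.
have -> : \sum_(0 <= n < N | (a <= n)%N) g a (n - a)%N = \sum_(0 + a <= n < N) g a (n - a)%N.
  by rewrite (big_nat_widenl (0 + a) 0) // add0n.
by rewrite big_addn; apply: eq_bigr => k _; rewrite addnK.
Qed.

(** Extended by zero, a summand on the rectangle becomes one on the triangle of side [N + K], to
    which [big_triangle] applies. This is how products of box sums become convolutions. *)
Lemma big_regroup g N K :
  \sum_(i < N) \sum_(k < K) g i k =
  \sum_(n < N + K) \sum_(i < n.+1 | (i < N)%N && (n - i < K)%N) g i (n - i)%N.
Proof.
pose h i k := if (i < N)%N && (k < K)%N then g i k else 0.
transitivity (\sum_(n < N + K) \sum_(i < n.+1) h i (n - i)%N); last first.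
  by apply: eq_bigr => n _; rewrite [RHS]big_mkcond.
rewrite big_triangle (big_ord_widen (N + K) (fun i => \sum_(k < K) g i k)) ?leq_addr //.
rewrite big_mkcond; apply: eq_bigr => i _; rewrite /h; case: ifP => iN /=; last first.
  by rewrite big1.
have KL : (K <= N + K - i)%N by lia.
by rewrite (big_ord_widen _ (fun k => g i k) KL) big_mkcond.
Qed.

End DoubleSums.

Arguments sumsZ {R} k g v _.

(** * Power series in two variables: products, change of centre, first-order expansion *)

Section PowerSeries.
Local Open Scope classical_set_scope.
Local Open Scope ring_scope.
Context {R : realType}.
Implicit Types (c d : nat -> nat -> R) (rho M s t : R).

Definition term c s t i j : R := c i j * s ^+ i * t ^+ j.

Definition coef_bound c rho M := forall i j, `|c i j| * rho ^+ (i + j) <= M.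

Definition mul_series c d i j : R :=
  \sum_(a < i.+1) \sum_(b < j.+1) c a b * d (i - a)%N (j - b)%N.

(* The coefficients of the partial derivative of order [(a, b)], divided by [a! b!]. *)
Definition shift_series c (a b : nat) i j : R :=
  c (a + i)%N (b + j)%N *+ 'C(a + i, a) *+ 'C(b + j, b).

Lemma coef_bound_ge0 c rho M : coef_bound c rho M -> 0 <= M.
Proof. by move=> /(_ 0%N 0%N); rewrite expr0 mulr1; apply: le_trans. Qed.

Lemma coef_boundW c rho rho' M M' : 0 <= rho' <= rho -> M <= M' ->
  coef_bound c rho M -> coef_bound c rho' M'.
Proof.
move=> /andP[r0 rr] MM cM i j; apply: le_trans MM; apply: le_trans (cM i j).
by rewrite ler_wpM2l // lerXn2r // nnegrE (le_trans r0).
Qed.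

Lemma term_dominated c rho M s t th : 0 < rho -> coef_bound c rho M ->
  `|s| <= th * rho -> `|t| <= th * rho -> geom_dominated (term c s t) M th.
Proof.
move=> r0 cM sr tr i j.
have thr : 0 <= th * rho by apply: le_trans sr.
have th0 : 0 <= th by rewrite -(pmulr_lge0 _ r0).
rewrite /term !normrM !normrX.
apply: (@le_trans _ _ (`|c i j| * ((th * rho) ^+ i * (th * rho) ^+ j))).
  rewrite -mulrA ler_wpM2l // ler_pM ?exprn_ge0 // lerXn2r ?nnegrE //.
rewrite -exprD exprMn mulrCA [leRHS]mulrC ler_wpM2l ?exprn_ge0 //; exact: cM.
Qed.

Lemma natr_le_pow2 (n : nat) : (n.+1%:R : R) <= 2 ^+ n.
Proof. by rewrite -natrX ler_nat ltn_expl. Qed.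

Lemma bin_le_pow2 (n k : nat) : ('C(n, k)%:R : R) <= 2 ^+ n.
Proof.
rewrite -natrX ler_nat; have [kn|nk] := leqP k n; last by rewrite bin_small.
have -> : (2 ^ n = (1 + 1) ^ n)%N by [].
rewrite expnDn (bigD1 (inord k)) //= inordK // !exp1n !muln1; exact: leq_addr.
Qed.

(** Each of the (i+1)(j+1) products is at most M M' / rho^(i+j). Halving the radius absorbs their
    number, since n + 1 <= 2^n. *)
Lemma coef_bound_mul c d rho M M' : 0 < rho ->
  coef_bound c rho M -> coef_bound d rho M' ->
  coef_bound (mul_series c d) (rho / 2) (M * M').
Proof.
move=> r0 cM dM i j.
have M0 := coef_bound_ge0 cM; have M'0 := coef_bound_ge0 dM.
have rn0 n : 0 <= rho ^+ n by rewrite exprn_ge0 // ltW.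
have H : `|mul_series c d i j| * rho ^+ (i + j) <= i.+1%:R * (j.+1%:R * (M * M')).
  apply: (@le_trans _ _ (\sum_(a < i.+1) \sum_(b < j.+1) M * M')); last first.
    by rewrite !sumr_const !card_ord !mulr_natl.
  apply: le_trans (ler_wpM2r (rn0 _) (ler_norm_sum _ _ _)) _.
  rewrite mulr_suml; apply: ler_sum => a _.
  apply: le_trans (ler_wpM2r (rn0 _) (ler_norm_sum _ _ _)) _.
  rewrite mulr_suml; apply: ler_sum => b _.
  have -> : (i + j = (a + b) + ((i - a) + (j - b)))%N.
    by have := ltn_ord a; have := ltn_ord b; lia.
  by rewrite normrM exprD mulrACA ler_pM ?mulr_ge0.
have -> : `|mul_series c d i j| * (rho / 2) ^+ (i + j) =
    `|mul_series c d i j| * rho ^+ (i + j) / 2 ^+ (i + j).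
  by rewrite exprMn exprVn mulrA.
rewrite ler_pdivrMr ?exprn_gt0 //; apply: le_trans H _.
rewrite mulrA [leRHS]mulrC ler_wpM2r ?mulr_ge0 // exprD.
by rewrite ler_pM // natr_le_pow2.
Qed.

Lemma big_regroup2 (G : nat -> nat -> nat -> nat -> R) N K :
  box N (fun a b => box K (G a b)) =
  box (N + K) (fun n m => \sum_(a < n.+1 | (a < N)%N && (n - a < K)%N)
    \sum_(b < m.+1 | (b < N)%N && (m - b < K)%N) G a b (n - a)%N (m - b)%N).
Proof.
transitivity (\sum_(a < N) \sum_(i < K) \sum_(b < N) \sum_(j < K) G a b i j).
  by apply: eq_bigr => a _; rewrite exchange_big.
rewrite (big_regroup (fun a i => \sum_(b < N) \sum_(j < K) G a b i j)).
apply: eq_bigr => n _; rewrite [RHS]exchange_big /=; apply: eq_bigr => a _.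
by rewrite (big_regroup (fun b j => G a b (n - a)%N j)).
Qed.

(** The product of two box sums of side N is a box sum of side 2 N of truncated convolutions, which
    are the coefficients of [mul_series c d] on the box of side N. Tannery's theorem removes the
    truncation. *)
Lemma sums_mul c d rho M M' s t v w : 0 < rho ->
  coef_bound c rho M -> coef_bound d rho M' ->
  `|s| < rho / 2 -> `|t| < rho / 2 ->
  sums (term c s t) v -> sums (term d s t) w ->
  sums (term (mul_series c d) s t) (v * w).
Proof.
move=> r0 cM dM sr tr cv dw.
pose th := Num.max `|s| `|t| / (rho / 2).
have r20 : 0 < rho / 2 by rewrite divr_gt0.
have th0 : 0 <= th by rewrite divr_ge0 ?le_max ?normr_ge0 // ltW.
have th1 : th < 1 by rewrite ltr_pdivrMr // mul1r gt_max sr tr.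
have sth : `|s| <= th * (rho / 2) by rewrite /th mulfVK ?gt_eqF // le_max lexx.
have tth : `|t| <= th * (rho / 2) by rewrite /th mulfVK ?gt_eqF // le_max lexx orbT.
pose e N n m : R := \sum_(a < n.+1 | (a < N)%N && (n - a < N)%N)
  \sum_(b < m.+1 | (b < N)%N && (m - b < N)%N)
     term c s t a b * term d s t (n - a)%N (m - b)%N.
have eE N n m : e N n m = term (fun n m => \sum_(a < n.+1 | (a < N)%N && (n - a < N)%N)
  \sum_(b < m.+1 | (b < N)%N && (m - b < N)%N) c a b * d (n - a)%N (m - b)%N) s t n m.
  rewrite /e /term -mulrA !mulr_suml; apply: eq_bigr => a _.
  rewrite !mulr_suml; apply: eq_bigr => b _.
  have E (x : R) k (l : 'I_k.+1) : x ^+ k = x ^+ l * x ^+ (k - l).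
    by rewrite -exprD subnKC // -ltnS.
  rewrite (E s n a) (E t m b); ring.
have := @tannery R (term (mul_series c d) s t) e (fun N => N + N)%N (M * M') th (v * w).
case => [||||_].
- by rewrite th0.
- move=> N n m; rewrite eE.
  (* A truncated convolution need not be smaller than the full one, but it is bounded by the full
     convolution of the absolute values. *)
  have cM' : coef_bound (fun i j => `|c i j|) rho M by move=> i j; rewrite normr_id.
  have dM' : coef_bound (fun i j => `|d i j|) rho M' by move=> i j; rewrite normr_id.
  apply: le_trans (term_dominated r20 (coef_bound_mul r0 cM' dM') sth tth n m).
  rewrite /term !normrM -!mulrA ler_wpM2r ?mulr_ge0 //.
  apply: le_trans (ler_norm_sum _ _ _) _; apply: le_trans _ (ler_norm _).
  rewrite big_mkcond; apply: ler_sum => a _; case: ifP => _; last first.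
    by apply: sumr_ge0 => b _; apply: mulr_ge0.
  apply: le_trans (ler_norm_sum _ _ _) _.
  rewrite big_mkcond; apply: ler_sum => b _; case: ifP => _; rewrite ?normrM //.
- by move=> N; rewrite leq_addr.
- move=> N i j iN jN; rewrite eE /term /mul_series; congr (_ * _ * _).
  rewrite big_mkcond; apply: eq_bigr => a _.
  rewrite ifT; last by have := ltn_ord a; lia.
  rewrite big_mkcond; apply: eq_bigr => b _.
  by rewrite ifT //; have := ltn_ord b; lia.
- apply.
  have -> : (fun N => box (N + N) (e N)) =
      (fun N => box N (term c s t) * box N (term d s t)).
    apply/funext => N; rewrite -(big_regroup2 (fun a b i j => term c s t a b * term d s t i j)).
    rewrite {2}/box mulr_suml; apply: eq_bigr => a _; rewrite mulr_suml.
    by apply: eq_bigr => b _; rewrite -boxZ.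
  exact: cvgM.
Qed.

(** Halving the radius absorbs the binomial coefficients, as 'C(n, k) <= 2^n; the powers of rho
    missing from the shifted series give the factor (2 / rho)^(a+b). *)
Lemma coef_bound_shift c rho M a b : 0 < rho -> coef_bound c rho M ->
  coef_bound (shift_series c a b) (rho / 2) (M * (2 / rho) ^+ (a + b)).
Proof.
move=> r0 cM i j.
rewrite -[2 / rho]invf_div exprVn ler_pdivlMr ?exprn_gt0 ?divr_gt0 //.
rewrite -mulrA -exprD exprMn exprVn /shift_series -mulrnA -[c _ _ *+ _]mulr_natl natrM.
rewrite !normrM !normr_nat.
have -> : (i + j + (a + b) = (a + i) + (b + j))%N by lia.
set k := (a + i)%N; set l := (b + j)%N.
have := cM k l; rewrite (exprD 2 k l) invfM => H.
have -> : 'C(k, a)%:R * 'C(l, b)%:R * `|c k l| * (rho ^+ (k + l) * ((2 ^+ k)^-1 / 2 ^+ l)) =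
  ('C(k, a)%:R / 2 ^+ k) * ('C(l, b)%:R / 2 ^+ l) * (`|c k l| * rho ^+ (k + l)) by ring.
have B n m : ('C(n, m)%:R / 2 ^+ n : R) <= 1.
  by rewrite ler_pdivrMr ?exprn_gt0 // mul1r bin_le_pow2.
apply: le_trans H; rewrite ler_piMl ?mulr_ge0 ?exprn_ge0 ?(ltW r0) //.
by rewrite mulr_ile1 ?B // divr_ge0 ?exprn_ge0.
Qed.

(** The binomial expansion, made finite by keeping fewer than [N] factors h and fewer than [K]
    factors y in each variable. As |y| + |h| <= rho / 2, every truncation is dominated with ratio
    1/2. Letting [K] tend to infinity for fixed [N] yields the box sums of the recentred series,
    within M [tail] of those of the original one, and then [N] tends to infinity. *)
Lemma sums_recenter c rho M y1 y2 h1 h2 (v : nat -> nat -> R) f : 0 < rho ->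
  coef_bound c rho M ->
  `|y1| <= rho / 4 -> `|y2| <= rho / 4 -> `|h1| < rho / 4 -> `|h2| < rho / 4 ->
  (forall a b, sums (term (shift_series c a b) y1 y2) (v a b)) ->
  sums (term c (y1 + h1) (y2 + h2)) f -> sums (term v h1 h2) f.
Proof.
move=> r0 cM y1r y2r h1r h2r sv sf.
have th01 : 0 <= (2^-1 : R) < 1 by lra.
(* The truncated expansion of (y + h)^n, complete as soon as n < N and n < K. *)
pose E N K n (h y : R) : R := \sum_(a < n.+1 | (a < N)%N && (n - a < K)%N)
  h ^+ a * y ^+ (n - a) *+ 'C(n, a).
have EE N K n h y : (n < N)%N -> (n < K)%N -> E N K n h y = (y + h) ^+ n.
  move=> nN nK; rewrite exprDn /E big_mkcond; apply: eq_bigr => a _.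
  by rewrite mulrC ifT //; have := ltn_ord a; lia.
have Eb N K n h y : `|y| <= rho / 4 -> `|h| < rho / 4 -> `|E N K n h y| <= (2^-1 * rho) ^+ n.
  move=> yr hr; apply: (@le_trans _ _ ((`|y| + `|h|) ^+ n)).
    rewrite exprDn; apply: le_trans (ler_norm_sum _ _ _) _.
    rewrite big_mkcond; apply: ler_sum => a _; case: ifP => _; last first.
      by rewrite mulrn_wge0 // mulr_ge0.
    by rewrite normrMn normrM !normrX mulrC.
  by rewrite lerXn2r ?nnegrE ?addr_ge0 //; lra.
pose g := term c (y1 + h1) (y2 + h2).
pose e N K n m := c n m * E N K n h1 y1 * E N K m h2 y2.
have e_dom N K : geom_dominated (e N K) M 2^-1.
  move=> i j; rewrite /e !normrM.
  apply: (@le_trans _ _ (`|c i j| * ((2^-1 * rho) ^+ i * (2^-1 * rho) ^+ j))).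
    by rewrite -mulrA ler_wpM2l // ler_pM // Eb.
  rewrite -exprD exprMn mulrCA [leRHS]mulrC ler_wpM2l ?exprn_ge0 //; exact: cM.
have e_box N K : box N (fun a b => h1 ^+ a * h2 ^+ b * box K (term (shift_series c a b) y1 y2))
    = box (N + K) (e N K).
  transitivity (box N (fun a b => box K (fun i j =>
      h1 ^+ a * h2 ^+ b * term (shift_series c a b) y1 y2 i j))).
    by apply: eq_box => a b _ _; rewrite -boxZ.
  rewrite big_regroup2; apply: eq_box => n m _ _.
  rewrite /e -mulrA [E N K n _ _ * _]mulr_suml mulr_sumr; apply: eq_bigr => a _.
  rewrite !mulr_sumr; apply: eq_bigr => b _.
  rewrite /term /shift_series !subnKC -1?ltnS //.
  by rewrite !(mulrnAl, mulrnAr) mulrnAC; congr (_ *+ _ *+ _); ring.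
apply: (sums_approx (e := fun N => M * tail 2^-1 N) _ _ sf); last exact: cvg_tailM.
move=> N; rewrite distrC.
have cv : (fun K => `|box N (fun a b => h1 ^+ a * h2 ^+ b *
      box K (term (shift_series c a b) y1 y2)) - box N g|) @ \oo -->
    `|box N (term v h1 h2) - box N g|.
  apply: cvg_norm; apply: cvgB; last exact: cvg_cst.
  have -> : box N (term v h1 h2) = box N (fun a b => h1 ^+ a * h2 ^+ b * v a b).
    by apply: eq_box => a b _ _; rewrite /term; ring.
  apply: cvg_big => [|a _]; first exact: add_continuous.
  apply: cvg_big => [|b _]; first exact: add_continuous.
  by apply: cvgM; [exact: cvg_cst | exact: sv].
rewrite -(cvg_lim _ cv) //; apply: limr_le; first exact: cvgP cv.
near=> K; rewrite e_box.
rewrite (@eq_box _ N g (e N K)) => [|i j iN jN].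
  by apply: box_diff => //; rewrite leq_addr.
have NK : (N <= K)%N by near: K; exact: nbhs_infty_ge.
by rewrite /e /g /term !EE // (leq_trans _ NK).
Unshelve. all: by end_near. Qed.

Lemma cvg_even (u : nat -> R) (v : R) : u @ \oo --> v -> (fun K => u (K + K)%N) @ \oo --> v.
Proof.
move=> uv; apply: (cvg_comp _ _ _ uv); apply/cvgnyPge => A.
by near do rewrite (leq_trans _ (leq_addr _ _)) //; exact: nbhs_infty_ge.
Unshelve. all: by end_near. Qed.

(** Restricting a series to a line requires summation by total degree. The degrees below 2 K contain
    the box of side K and fit in the box of side 2 K, as [tannery] demands. *)
Lemma sums_triangle (g : nat -> nat -> R) M th v : 0 <= th < 1 -> geom_dominated g M th ->
  sums g v ->
  (fun K => \sum_(n < K + K) \sum_(a < n.+1) g a (n - a)%N) @ \oo --> v.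
Proof.
move=> th01 gM gv; have M0 := geom_dominated_ge0 gM; have /andP[th0 _] := th01.
pose e K i j := if (i + j < K + K)%N then g i j else 0.
have -> : (fun K => \sum_(n < K + K) \sum_(a < n.+1) g a (n - a)%N) =
    (fun K => box (K + K) (e K)).
  apply/funext => K; rewrite big_triangle; apply: eq_bigr => a _.
  rewrite (big_ord_widen (K + K) (fun k => g a k)) ?leq_subr // big_mkcond.
  by apply: eq_bigr => k _; rewrite /e ltn_subRL.
apply/(@tannery R g e (fun K => K + K)%N M th v) => //.
- by move=> K i j; rewrite /e; case: ifP => _; [exact: gM | rewrite normr0 mulr_ge0 ?exprn_ge0].
- by move=> K; rewrite leq_addr.
- by move=> K i j iK jK; rewrite /e ifT //; lia.
Qed.

(** The box of side 2 holds the affine part and the term (1, 1). With th the ratio on the right,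
    this term is at most M th^2 and the rest at most 8 M th^2 for th <= 1/2, whence 9. *)
Lemma sums_expansion c rho M s t v : 0 < rho -> coef_bound c rho M ->
  `|s| <= rho / 2 -> `|t| <= rho / 2 -> sums (term c s t) v ->
  `|v - (c 0%N 0%N + c 1%N 0%N * s + c 0%N 1%N * t)|
    <= 9 * M * (Num.max `|s| `|t| / rho) ^+ 2.
Proof.
move=> r0 cM sr tr cv; set th := _ / rho.
have th0 : 0 <= th by rewrite divr_ge0 ?le_max ?normr_ge0 // ltW.
have th2 : th <= 2^-1 by rewrite ler_pdivrMr // ge_max mulrC sr tr.
have th1 : 0 <= th < 1 by lra.
have sth : `|s| <= th * rho by rewrite /th mulfVK ?gt_eqF // le_max lexx.
have tth : `|t| <= th * rho by rewrite /th mulfVK ?gt_eqF // le_max lexx orbT.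
have dom := term_dominated r0 cM sth tth.
have M0 := coef_bound_ge0 cM.
have H := sums_bound 2 th1 dom cv.
have D := dom 1%N 1%N.
have T : tail th 2 <= 8 * th ^+ 2.
  rewrite /tail !big_ord_recl big_ord0 /= expr0 expr1 addr0.
  have q0 : 0 < 1 - th by lra.
  rewrite exprVn lerBlDr.
  rewrite -div1r ler_pdivrMr ?exprn_gt0 //.
  have : 0 <= th ^+ 2 by rewrite exprn_ge0.
  nra.
have B2 : box 2 (term c s t) =
    c 0%N 0%N + c 1%N 0%N * s + c 0%N 1%N * t + term c s t 1%N 1%N.
  rewrite /box !big_ord_recl !big_ord0 /term /= /bump /= !addn0; ring.
rewrite B2 in H.
have -> : v - (c 0%N 0%N + c 1%N 0%N * s + c 0%N 1%N * t) =
  v - (c 0%N 0%N + c 1%N 0%N * s + c 0%N 1%N * t + term c s t 1%N 1%N) + term c s t 1%N 1%N.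
  ring.
apply: le_trans (ler_normD _ _) _.
have := ler_wpM2l M0 T; rewrite /= in D *; lra.
Qed.

End PowerSeries.

(** * Germs of analytic functions and their derivatives *)

Section Germs.
Local Open Scope classical_set_scope.
Local Open Scope ring_scope.
Context {R : realType}.

Lemma norm_coord_le m n (x : 'M[R]_(m, n)) i j : `|x i j| <= `|x|.
Proof.
by rewrite [leRHS]/Num.Def.normr /= mx_normrE (le_bigmax _ _ (i, j)).
Qed.

Lemma norm_mx_lt m n (x : 'M[R]_(m, n)) r : 0 < r ->
  (forall i j, `|x i j| < r) -> `|x| < r.
Proof.
move=> r0 xr; rewrite [ltLHS]/Num.Def.normr /= mx_normrE.
by apply/bigmax_ltP; split => // -[i j] _; exact: xr.
Qed.

Lemma near_norm n (a : 'rV[R]_n) (r : R) : 0 < r -> \forall x \near a, `|x - a| < r.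
Proof.
move=> r0; apply/nbhs_ballP; exists r => //= x.
by rewrite mx_norm_ball /ball_ /= distrC.
Qed.

Lemma near_normP n (a : 'rV[R]_n) (P : set 'rV[R]_n) :
  (\forall x \near a, P x) -> exists2 r : R, 0 < r & forall x, `|x - a| < r -> P x.
Proof.
move=> /nbhs_ballP[r /= r0 aP]; exists r => // x xr; apply: aP.
by rewrite mx_norm_ball /ball_ /= distrC.
Qed.

Lemma big_ffun2 N (F : 'I_N -> 'I_N -> R) :
  \sum_(k : {ffun 'I_2 -> 'I_N}) F (k 0) (k 1) = \sum_(i < N) \sum_(j < N) F i j.
Proof.
rewrite pair_big /=.
rewrite (reindex (fun p : 'I_N * 'I_N => [ffun i : 'I_2 => if i == 0 then p.1 else p.2])) /=.
  by apply: eq_bigr => -[i j] _; rewrite !ffunE.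
exists (fun k => (k 0, k 1)) => [[i j] _|k _]; first by rewrite !ffunE.
apply/ffunP => i; rewrite ffunE; case: ifPn => [/eqP->//|i0]; congr (k _).
by apply: val_inj; case: i i0 => -[|[|]].
Qed.

Lemma big_ffun1 N (F : 'I_N -> R) :
  \sum_(k : {ffun 'I_1 -> 'I_N}) F (k 0) = \sum_(i < N) F i.
Proof.
rewrite (reindex (fun i : 'I_N => [ffun _ : 'I_1 => i])) /=.
  by apply: eq_bigr => i _; rewrite ffunE.
exists (fun k => k 0) => [i _|k _]; first by rewrite ffunE.
by apply/ffunP => i; rewrite ffunE ord1.
Qed.

Definition germ (f : 'rV[R]_2 -> R) (a : 'rV[R]_2) c (rho M : R) :=
  [/\ 0 < rho, coef_bound c rho M &
      forall x, `|x - a| < rho -> sums (term c ((x - a) 0 0) ((x - a) 0 1)) (f x)].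

Lemma big_ord2 (V : nmodType) (F : 'I_2 -> V) : \sum_i F i = F 0 + F 1.
Proof. by rewrite !big_ord_recl big_ord0 addr0; congr (_ + F _); apply: val_inj. Qed.

Lemma prod_ord2 (F : 'I_2 -> R) : \prod_i F i = F 0 * F 1.
Proof. by rewrite !big_ord_recl big_ord0 mulr1; congr (_ * F _); apply: val_inj. Qed.

Lemma sum_ord2 (F : 'I_2 -> nat) : (\sum_i F i = F 0%R + F 1%R)%N.
Proof. by rewrite !big_ord_recl big_ord0 addn0; congr (_ + F _)%N; apply: val_inj. Qed.

Lemma analytic_at2P (f : 'rV[R]_2 -> R) a :
  analytic_at f a <-> exists c rho M, germ f a c rho M.
Proof.
split=> [[rho [M [c [r0 cM cf]]]]|[c [rho [M [r0 cM cf]]]]].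
  pose pt (i j : nat) : {ffun 'I_2 -> nat} := [ffun l : 'I_2 => if l == 0 then i else j].
  exists (fun i j => c (pt i j)), rho, M; split => // [i j|x /cf].
    by have := cM (pt i j); rewrite sum_ord2 !ffunE.
  apply: cvg_trans; apply: near_eq_cvg; apply: nearW => N /=.
  rewrite /box -(big_ffun2 (fun i j : 'I_N => term (fun i j => c (pt i j)) _ _ i j)).
  apply: eq_bigr => k _; rewrite prod_ord2 /term -mulrA; congr (c _ * _).
  apply/ffunP => i; rewrite !ffunE; case: ifPn => [/eqP->//|i0]; congr (nat_of_ord (k _)).
  by apply: val_inj; case: i i0 => -[|[|]].
exists rho, M, (fun k => c (k 0) (k 1)); split => // [k|x /cf].
  by rewrite sum_ord2.
apply: cvg_trans; apply: near_eq_cvg; apply: nearW => N /=.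
rewrite /box -(big_ffun2 (fun i j : 'I_N => term c _ _ i j)).
by apply: eq_bigr => k _; rewrite prod_ord2 !ffunE mulrA.
Qed.

Lemma analytic1_atP (phi : R -> R) : analytic1_at phi 0 ->
  exists (b : nat -> R) rho M, [/\ 0 < rho, forall n, `|b n| * rho ^+ n <= M &
    forall t, `|t| < rho -> (fun N => \sum_(n < N) b n * t ^+ n) @ \oo --> phi t].
Proof.
move=> [rho [M [c [r0 cM cf]]]].
exists (fun n => c [ffun=> n]), rho, M; split => // [n|t tr].
  by have := cM [ffun=> n]; rewrite big_ord_recl big_ord0 ffunE addn0.
have := cf (const_mx t); rewrite mxE => /(_ _)/wrap[].
  by apply: norm_mx_lt => // i j; rewrite !mxE subr0.
apply: cvg_trans; apply: near_eq_cvg; apply: nearW => N /=.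
rewrite -(big_ffun1 (fun n : 'I_N => c [ffun=> nat_of_ord n] * t ^+ n)).
apply: eq_bigr => k _; rewrite big_ord_recl big_ord0 mulr1 !mxE subr0; congr (c _ * _).
by apply/ffunP => i; rewrite !ffunE ord1.
Qed.

Lemma is_derive_quadratic (V : normedModType R) (f : V -> R) (a v : V) (l K r : R) : 0 < r ->
  (forall h : R, `|h| < r -> `|f (h *: v + a) - f a - h * l| <= K * h ^+ 2) ->
  is_derive a v f l.
Proof.
move=> r0 H.
have cv : h^-1 *: ((f \o shift a) (h *: v) - f a) @[h --> 0^'] --> l.
  apply/cvgrPdist_le => /= e e0; near=> h.
  have h0 : h != 0 by near: h; exact: nbhs_dnbhs_neq.
  have hr : `|h| < r by near: h; exact: dnbhs0_lt.
  have he : `|h| < e / (`|K| + 1) by near: h; apply: dnbhs0_lt; rewrite divr_gt0 // ltr_wpDl.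
  rewrite /shift /= /GRing.scale /=.
  have -> : l - h^-1 * (f (h *: v + a) - f a) = - (h^-1 * (f (h *: v + a) - f a - h * l)).
    by field.
  rewrite normrN normrM normfV ler_pdivrMl ?normr_gt0 //.
  apply: le_trans (H h hr) _; rewrite -real_normK ?num_real // expr2 mulrCA ler_wpM2l //.
  apply: le_trans (ler_wpM2r (normr_ge0 h) (ler_norm K)) _.
  move: he; rewrite ltr_pdivlMr ?ltr_wpDl // => he.
  by apply: le_trans (ltW he); rewrite mulrC ler_wpM2l // lerDl.
exact: DeriveDef (cvgP _ cv) (cvg_lim _ cv).
Unshelve. all: by end_near. Qed.

Lemma germ_at_center f a c rho M : germ f a c rho M -> f a = c 0%N 0%N.
Proof.
move=> [r0 cM cf]; have := cf a; rewrite subrr normr0 !mxE => /(_ r0) sf.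
have := sums_expansion r0 cM _ _ sf; rewrite normr0 !mulr0 !addr0 maxxx mul0r expr0n /= mulr0.
by rewrite divr_ge0 ?(ltW r0) // => /(_ isT isT); rewrite normr_le0 subr_eq0 => /eqP.
Qed.

Lemma germ_is_derive f a c rho M (v : 'rV[R]_2) : germ f a c rho M ->
  is_derive a v f (c 1%N 0%N * v 0 0 + c 0%N 1%N * v 0 1).
Proof.
move=> g; have [r0 cM cf] := g; have M0 := coef_bound_ge0 cM.
(* [|v| + 1] rather than [|v|], so that one can divide by it when [v] is zero. *)
have v0 : 0 < `|v| + 1 by rewrite ltr_wpDl.
apply: (@is_derive_quadratic _ _ _ _ _ (9 * M * ((`|v| + 1) / rho) ^+ 2) (rho / 2 / (`|v| + 1))).
  by rewrite !divr_gt0.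
move=> h; rewrite ltr_pdivlMr // => hr; rewrite (germ_at_center g).
have hv i : `|(h *: v) 0 i| <= `|h| * (`|v| + 1).
  by rewrite mxE normrM ler_wpM2l // (le_trans (norm_coord_le _ _ _)) // lerDl.
have hv2 i : `|(h *: v) 0 i| <= rho / 2 by apply: le_trans (hv i) (ltW hr).
have := cf (h *: v + a); rewrite addrK => /(_ _)/wrap[|sf].
  apply: norm_mx_lt => // i j; rewrite ord1; apply: le_lt_trans (hv2 _) _.
  by rewrite ltr_pdivrMr //; lra.
have := sums_expansion r0 cM (hv2 0) (hv2 1) sf; rewrite !mxE => E.
have -> : f (h *: v + a) - c 0%N 0%N - h * (c 1%N 0%N * v 0 0 + c 0%N 1%N * v 0 1) =
  f (h *: v + a) - (c 0%N 0%N + c 1%N 0%N * (h * v 0 0) + c 0%N 1%N * (h * v 0 1)) by ring.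
apply: le_trans E _; rewrite -[leRHS]mulrA ler_wpM2l ?mulr_ge0 //.
rewrite -[h ^+ 2]real_normK ?num_real // -exprMn lerXn2r ?nnegrE //.
- by rewrite divr_ge0 ?le_max ?normr_ge0 // ltW.
- by rewrite mulr_ge0 // divr_ge0 // ltW.
rewrite mulrAC ler_wpM2r ?invr_ge0 ?(ltW r0) // [leRHS]mulrC.
by have := hv 0; have := hv 1; rewrite !mxE ge_max => -> ->.
Qed.

(** [lim] makes the sum a total function; its value is meaningful only where the series
    converges. *)
Definition ev c (a x : 'rV[R]_2) : R :=
  lim ((fun N => box N (term c ((x - a) 0 0) ((x - a) 0 1))) @ \oo).

Lemma term_dominated_norm c rho M (y : 'rV[R]_2) th : 0 < rho -> coef_bound c rho M ->
  `|y| <= th * rho -> geom_dominated (term c (y 0 0) (y 0 1)) M th.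
Proof.
move=> r0 cM yr; apply: (term_dominated r0 cM); apply: le_trans yr; exact: norm_coord_le.
Qed.

Lemma norm_ratio n (y : 'rV[R]_n) rho : 0 < rho -> `|y| < rho ->
  exists2 th : R, 0 <= th < 1 & `|y| <= th * rho.
Proof.
move=> r0 yr; exists (`|y| / rho); last by rewrite mulfVK ?gt_eqF.
by rewrite divr_ge0 ?(ltW r0) //= ltr_pdivrMr // mul1r.
Qed.

Lemma germ_ev c (a : 'rV[R]_2) rho M : 0 < rho -> coef_bound c rho M ->
  germ (ev c a) a c rho M.
Proof.
move=> r0 cM; split => // x /(norm_ratio r0)[th th01 xth].
have [v sv] := sums_ex th01 (term_dominated_norm r0 cM xth).
by rewrite /ev (cvg_lim _ sv).
Qed.

Lemma germW f a c rho M rho' M' : 0 < rho' <= rho -> M <= M' -> germ f a c rho M ->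
  germ f a c rho' M'.
Proof.
move=> /andP[r0 rr] MM [_ cM cf]; split => // [|x xr].
  by apply: coef_boundW MM cM; rewrite rr ltW.
by apply: cf; apply: lt_le_trans rr.
Qed.

Lemma germ_unique f g a c rho M rho' M' (x : 'rV[R]_2) : germ f a c rho M -> germ g a c rho' M' ->
  `|x - a| < rho -> `|x - a| < rho' -> f x = g x.
Proof. by move=> [_ _ cf] [_ _ cg] /cf cfx /cg /(sums_unique cfx). Qed.

(** Compared with the empty box, the error is the whole geometric majorant of ratio 1/2, and (1 -
    1/2)^-2 = 4. *)
Lemma germ_bounded f a c rho M (x : 'rV[R]_2) : germ f a c rho M -> `|x - a| <= rho / 2 ->
  `|f x| <= M * 4.
Proof.
move=> [r0 cM cf] xr; have th01 : 0 <= (2^-1 : R) < 1 by lra.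
have xr' : `|x - a| < rho by apply: le_lt_trans xr _; lra.
have xr2 : `|x - a| <= 2^-1 * rho by rewrite mulrC.
have := sums_bound 0 th01 (term_dominated_norm r0 cM xr2) (cf x xr').
rewrite /box /tail !big_ord0 subr0 expr0n /= subr0.
suff -> : (1 - 2^-1 : R)^-1 ^+ 2 = 4 by [].
by field.
Qed.

Lemma germ_mul f g a c d rho M M' : germ f a c rho M -> germ g a d rho M' ->
  germ (fun x => f x * g x) a (mul_series c d) (rho / 2) (M * M').
Proof.
move=> [r0 cM cf] [_ dM dg]; split; [by rewrite divr_gt0 | exact: coef_bound_mul |].
move=> x xr; have xr' : `|x - a| < rho by apply: lt_trans xr _; lra.
by apply: (sums_mul r0 cM dM _ _ (cf x xr') (dg x xr'));
  apply: le_lt_trans xr; exact: norm_coord_le.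
Qed.

Lemma germD f g a c d rho M M' : germ f a c rho M -> germ g a d rho M' ->
  germ (fun x => f x + g x) a (fun i j => c i j + d i j) rho (M + M').
Proof.
move=> [r0 cM cf] [_ dM dg]; split => // [i j|x xr].
  apply: le_trans (lerD (cM i j) (dM i j)); rewrite -mulrDl ler_wpM2r ?exprn_ge0 ?(ltW r0) //.
  exact: ler_normD.
apply: (eq_sums _ (sumsD (cf x xr) (dg x xr))) => i j; rewrite /term; ring.
Qed.

Lemma germZ k f a c rho M : germ f a c rho M ->
  germ (fun x => k * f x) a (fun i j => k * c i j) rho (`|k| * M).
Proof.
move=> [r0 cM cf]; split => // [i j|x xr].
  by rewrite normrM -mulrA ler_wpM2l.
have := sumsZ k _ _ (cf x xr); apply: eq_sums => i j; rewrite /term; ring.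
Qed.

Lemma germ_cst k a rho : 0 < rho ->
  germ (fun=> k) a (fun i j => if (i + j == 0)%N then k else 0) rho `|k|.
Proof.
move=> r0; split => // [i j|x xr].
  case: ifPn => [/eqP->|_]; first by rewrite expr0 mulr1.
  by rewrite normr0 mul0r.
apply: cvg_near_cst; near=> N; have N0 : (0 < N)%N by near: N; exact: nbhs_infty_gt.
rewrite /box (bigD1 (Ordinal N0)) //= (bigD1 (Ordinal N0)) //= /term addn0 eqxx !expr0 !mulr1.
rewrite !big1 ?addr0 // => i; rewrite -val_eqE /= => i0.
  apply: big1 => j _; rewrite addn_eq0 (negbTE i0) /=; ring.
by rewrite add0n (negbTE i0); ring.
Unshelve. all: by end_near. Qed.

(** The new coefficients are the divided derivatives of [f] at [y]. Their series have radius rho /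
    2, hence [germ_bounded] controls them at distance rho / 4 from [a]: at most 4 M (2 / rho)^(i+j),
    which radius rho / 4 turns into 4 M 2^-(i+j). *)
Lemma germ_recenter f a c rho M (y : 'rV[R]_2) : germ f a c rho M -> `|y - a| < rho / 4 ->
  exists2 c', germ f y c' (rho / 4) (M * 4) &
    forall i j, c' i j = ev (shift_series c i j) a y.
Proof.
move=> [r0 cM cf] yr.
have y4 i : `|(y - a) 0 i| <= rho / 4 by apply: le_trans (norm_coord_le _ _ _) (ltW yr).
have sv i j : [/\ sums (term (shift_series c i j) ((y - a) 0 0) ((y - a) 0 1))
      (ev (shift_series c i j) a y) &
    `|ev (shift_series c i j) a y| <= M * (2 / rho) ^+ (i + j) * 4].
  have cs := coef_bound_shift i j r0 cM.
  have g := germ_ev a (divr_gt0 r0 (ltr0n R 2)) cs.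
  split; last by apply: (germ_bounded g); move: yr; lra.
  by case: g => _ _; apply; move: yr; lra.
exists (fun i j => ev (shift_series c i j) a y) => //; split; first by rewrite divr_gt0.
  move=> i j; have [_ H] := sv i j.
  apply: le_trans (ler_wpM2r _ H) _; first by rewrite exprn_ge0 // divr_ge0 // ltW.
  have -> : M * (2 / rho) ^+ (i + j) * 4 * (rho / 4) ^+ (i + j) = M * 4 * 2^-1 ^+ (i + j).
    have <- : (2 / rho) ^+ (i + j) * (rho / 4) ^+ (i + j) = 2^-1 ^+ (i + j).
      by rewrite -exprMn; congr (_ ^+ _); field; rewrite gt_eqF.
    by move: (_ ^+ _) (_ ^+ _) => p q; ring.
  by rewrite ler_piMr ?mulr_ge0 ?(coef_bound_ge0 cM) // exprn_ile1 //; lra.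
move=> x xr.
have h4 i : `|(x - y) 0 i| < rho / 4 by apply: le_lt_trans (norm_coord_le _ _ _) xr.
apply: (@sums_recenter _ c rho M ((y - a) 0 0) ((y - a) 0 1)) => //.
  by move=> i j; case: (sv i j).
have E i : (y - a) 0 i + (x - y) 0 i = (x - a) 0 i by rewrite !mxE; ring.
rewrite !E; apply: cf; have -> : x - a = (y - a) + (x - y) by rewrite [RHS]addrC subrKA.
apply: le_lt_trans (ler_normD _ _) _; lra.
Qed.

(** A solution must be analytic and satisfy the equations at every point near [a]. Recentring makes
    such a point the centre of a series, where the derivative is read off the coefficients of degree
    one. *)
Lemma germ_near f a c rho M (y : 'rV[R]_2) : germ f a c rho M -> `|y - a| < rho / 4 ->
  analytic_at f y /\ forall v : 'rV[R]_2, is_derive y v f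
    (ev (shift_series c 1 0) a y * v 0 0 + ev (shift_series c 0 1) a y * v 0 1).
Proof.
move=> g /(germ_recenter g)[c' g' c'E]; split.
  by apply/analytic_at2P; exists c', (rho / 4), (M * 4).
by move=> v; rewrite -!c'E; apply: germ_is_derive g'.
Qed.

End Germs.

(** * The formal solution of the Cauchy problem and the bound on its coefficients *)

Section FormalSolution.
Local Open Scope ring_scope.
Context {R : realType}.
Implicit Types (c d f g : nat -> nat -> R) (u v : nat -> nat -> nat -> R).

Definition transpose_series c i j := c j i.

(* The series [c] with [d_2 c = f], [c(0) = w], and whose derivative [d_1 c] restricts to
   [\sum_n b n t^n] on the line [t |-> (t Y1, t Y2)]. *)
Definition solve_series (Y1 Y2 : R) (b : nat -> R) (w : R) f i j : R :=
  if j is l.+1 then f i l / l.+1%:R else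
  if i is n.+1 then
    (b n - \sum_(k < n) k.+1%:R * (f k.+1 (n - k.+1)%N / (n - k)%:R) * Y1 ^+ k * Y2 ^+ (n - k))
      / (n.+1%:R * Y1 ^+ n)
  else w.

Lemma solve_series_d2 Y1 Y2 b w f i j :
  j.+1%:R * solve_series Y1 Y2 b w f i j.+1 = f i j.
Proof. by rewrite /= mulrC divfK. Qed.

(** On the line, degree n of d_1 c involves the coefficients (k+1, n-k) for k <= n. Those with k < n
    are fixed by d_2 c = f; the case of axis coefficients in the definition solves for the remaining
    one, (n+1, 0), whose factor is (n+1) Y1^n. *)
Lemma solve_series_line Y1 Y2 b w f n : Y1 != 0 ->
  \sum_(k < n.+1) k.+1%:R * solve_series Y1 Y2 b w f k.+1 (n - k)%N * Y1 ^+ k * Y2 ^+ (n - k)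
  = b n.
Proof.
move=> Y0; rewrite big_ord_recr /= subnn expr0 mulr1.
pose S := \sum_(k < n) k.+1%:R * (f k.+1 (n - k.+1)%N / (n - k)%:R) * Y1 ^+ k * Y2 ^+ (n - k).
rewrite -/S (eq_bigr (fun k : 'I_n =>
    k.+1%:R * (f k.+1 (n - k.+1)%N / (n - k)%:R) * Y1 ^+ k * Y2 ^+ (n - k))) => [|k _].
  by rewrite -/S /= -/S; field; rewrite expf_neq0 //= addrC natr1 pnatr_eq0.
by have -> : (n - k = (n - k.+1).+1)%N by have := ltn_ord k; lia.
Qed.

Lemma solve_series_local Y1 Y2 b w f g n :
  (forall i j, (i + j < n)%N -> f i j = g i j) ->
  forall i j, (i + j < n.+1)%N -> solve_series Y1 Y2 b w f i j = solve_series Y1 Y2 b w g i j.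
Proof.
move=> fg [|i] [|j] //= ijn; rewrite ?fg //; try lia.
congr ((_ - _) / _); apply: eq_bigr => k _; rewrite fg //; have := ltn_ord k; lia.
Qed.

Definition wnorm (A B : R) N c : R := box N (fun i j => `|c i j| * A ^+ i * B ^+ j).

Lemma wnorm_ge0 A B N c : 0 <= A -> 0 <= B -> 0 <= wnorm A B N c.
Proof. by move=> A0 B0; apply: box_ge0 => i j; rewrite !mulr_ge0 ?exprn_ge0. Qed.

Lemma wnorm_transpose A B N c : wnorm A B N (transpose_series c) = wnorm B A N c.
Proof.
rewrite /wnorm -box_swap; apply: eq_box => i j _ _; rewrite /transpose_series; ring.
Qed.

Lemma wnormD A B N c d : 0 <= A -> 0 <= B ->
  wnorm A B N (fun i j => c i j + d i j) <= wnorm A B N c + wnorm A B N d.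
Proof.
move=> A0 B0; rewrite /wnorm -boxD; apply: ler_box => i j _ _.
by rewrite -!mulrDl -!mulrA ler_wpM2r ?ler_normD // mulr_ge0 ?exprn_ge0.
Qed.

Lemma wnorm_sign A B N c (s : R) : `|s| = 1 -> wnorm A B N (fun i j => s * c i j) = wnorm A B N c.
Proof. by move=> s1; apply: eq_box => i j _ _; rewrite normrM s1 mul1r. Qed.

Lemma ler_triangle g N : (forall i j, 0 <= g i j) ->
  \sum_(n < N) \sum_(a < n.+1) g a (n - a)%N <= box N g.
Proof.
move=> g0; rewrite big_triangle; apply: ler_sum => a _.
by apply: (@ler_sum_widen _ (fun k => g a k)) => //; rewrite leq_subr.
Qed.

(** Truncation does no harm: a coefficient of the product inside the box uses only coefficients of
    the factors inside it, and the remaining pairs of the product of the norms contribute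
    nonnegative terms. *)
Lemma wnorm_mul A B N c d : 0 <= A -> 0 <= B ->
  wnorm A B N (mul_series c d) <= wnorm A B N c * wnorm A B N d.
Proof.
move=> A0 B0.
pose wt (c : nat -> nat -> R) i j := `|c i j| * A ^+ i * B ^+ j.
have wt0 c' i j : 0 <= wt c' i j by rewrite !mulr_ge0 ?exprn_ge0.
apply: (@le_trans _ _ (\sum_(n < N) \sum_(a < n.+1) \sum_(m < N) \sum_(b < m.+1)
    wt c a b * wt d (n - a)%N (m - b)%N)).
  apply: ler_sum => n _; rewrite exchange_big /=; apply: ler_sum => m _.
  rewrite /mul_series -mulrA.
  apply: le_trans (ler_wpM2r _ (ler_norm_sum _ _ _)) _; first by rewrite mulr_ge0 ?exprn_ge0.
  rewrite mulr_suml; apply: ler_sum => a _.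
  apply: le_trans (ler_wpM2r _ (ler_norm_sum _ _ _)) _; first by rewrite mulr_ge0 ?exprn_ge0.
  rewrite mulr_suml; apply: ler_sum => b _; rewrite normrM.
  have E (x : R) k (l : 'I_k.+1) : x ^+ k = x ^+ l * x ^+ (k - l).
    by rewrite -exprD subnKC // -ltnS.
  by rewrite (E A n a) (E B m b) /wt le_eqVlt; apply/orP; left; apply/eqP; ring.
apply: (le_trans (ler_triangle (g := fun a k => \sum_(m < N) \sum_(b < m.+1)
    wt c a b * wt d k (m - b)%N) N _)) => [i j|].
  by do 2! (apply: sumr_ge0 => ? _); rewrite mulr_ge0.
have T : box N (fun a k => \sum_(m < N) \sum_(b < m.+1) wt c a b * wt d k (m - b)%N) <=
    box N (fun a k => box N (fun b l => wt c a b * wt d k l)).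
  apply: ler_box => a k _ _.
  by apply: (ler_triangle (g := fun b l => wt c a b * wt d k l)) => b l; rewrite mulr_ge0.
apply: le_trans T _.
rewrite /wnorm -/(wt c) -/(wt d) le_eqVlt; apply/orP; left; apply/eqP.
rewrite /box mulr_suml; apply: eq_bigr => a _.
rewrite exchange_big mulr_suml /=; apply: eq_bigr => b _.
rewrite mulr_sumr; apply: eq_bigr => k _.
by rewrite mulr_sumr.
Qed.

(** The weights are adapted to the line. Dividing A^(n+1) by |Y1|^n leaves A rho^n, and then |Y1|^k
    |Y2|^(n-k) A rho^n = B A^(k+1) B^(n-k-1), the weight of the coefficient of [f] concerned times
    B. The factor k + 1 is compensated by the division by n + 1. *)
Lemma solve_series_axis_le (rho Y1 Y2 : R) b w f n  (A B : R) : 0 < rho -> Y1 != 0 ->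
  A = rho * `|Y1| -> B = rho * `|Y2| ->
  `|solve_series Y1 Y2 b w f n.+1 0%N| * A ^+ n.+1 <= A * (`|b n| * rho ^+ n) +
    B * \sum_(a < n.+1) `|f a (n - a)%N| * A ^+ a * B ^+ (n - a).
Proof.
move=> r0 Y0 AE BE; have Y1p : 0 < `|Y1| by rewrite normr_gt0.
have A0 : 0 <= A by rewrite AE mulr_ge0 // ltW.
have B0 : 0 <= B by rewrite BE mulr_ge0 // ltW.
have W0 i j : 0 <= `|f i j| * A ^+ i * B ^+ j by rewrite !mulr_ge0 ?exprn_ge0.
have n0 : (0 : R) < n.+1%:R by rewrite ltr0n.
pose g k := k.+1%:R * (f k.+1 (n - k.+1)%N / (n - k)%:R) * Y1 ^+ k * Y2 ^+ (n - k).
have H : `|\sum_(k < n) g k| * (A * rho ^+ n) <= n.+1%:R *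
    (B * \sum_(a < n.+1) `|f a (n - a)%N| * A ^+ a * B ^+ (n - a)).
  apply: (@le_trans _ _ (n.+1%:R *
      (B * \sum_(k < n) `|f k.+1 (n - k.+1)%N| * A ^+ k.+1 * B ^+ (n - k.+1)))); last first.
    by rewrite !ler_wpM2l ?(ltW n0) // [leRHS]big_ord_recl lerDr.
  apply: le_trans (ler_wpM2r _ (ler_norm_sum _ _ _)) _.
    by rewrite mulr_ge0 ?exprn_ge0 ?(ltW r0).
  rewrite mulr_suml !mulr_sumr; apply: ler_sum => k _.
  rewrite /g !normrM normfV !normr_nat !normrX.
  have E : (n - k = (n - k.+1).+1)%N by have := ltn_ord k; lia.
  have Er : rho ^+ n = rho ^+ k * rho ^+ (n - k.+1).+1.
    by rewrite -exprD; congr (_ ^+ _); have := ltn_ord k; lia.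
  pose W := `|f k.+1 (n - k.+1)%N| * `|Y1| ^+ k * `|Y2| ^+ (n - k) * (A * rho ^+ n).
  have -> : B * (`|f k.+1 (n - k.+1)%N| * A ^+ k.+1 * B ^+ (n - k.+1)) = W.
    rewrite /W E Er AE BE !exprMn !exprS; ring.
  have -> : k.+1%:R * (`|f k.+1 (n - k.+1)%N| / (n - k)%:R) * `|Y1| ^+ k * `|Y2| ^+ (n - k) *
      (A * rho ^+ n) = k.+1%:R / (n - k)%:R * W by rewrite /W; ring.
  rewrite ler_wpM2r ?mulr_ge0 ?exprn_ge0 ?(ltW r0) //.
  apply: (@le_trans _ _ k.+1%:R); last by rewrite ler_nat; have := ltn_ord k; lia.
  by rewrite ler_piMr // invf_le1 E ?ltr0n // ler1n.
have -> : solve_series Y1 Y2 b w f n.+1 0 = (b n - \sum_(k < n) g k) / (n.+1%:R * Y1 ^+ n) by [].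
rewrite normrM normfV normrM normr_nat normrX.
have -> : `|b n - \sum_(k < n) g k| / (n.+1%:R * `|Y1| ^+ n) * A ^+ n.+1 =
    `|b n - \sum_(k < n) g k| * (A * rho ^+ n) / n.+1%:R.
  rewrite exprS {2}AE exprMn; field.
  by rewrite expf_neq0 ?gt_eqF //= addrC natr1 gt_eqF.
rewrite ler_pdivrMr //.
apply: le_trans (ler_wpM2r _ (ler_normB _ _)) _; first by rewrite mulr_ge0 ?exprn_ge0 ?(ltW r0).
rewrite mulrDl mulrDl mulrCA; apply: lerD; last by rewrite [leRHS]mulrC.
by rewrite ler_peMr ?mulr_ge0 ?exprn_ge0 ?(ltW r0) // ler1n.
Qed.

(** One multiple [B * wnorm A B N f] comes from the coefficients with j > 0, the other from the axis
    j = 0 together with the data [b]. Both A and B are proportional to rho, the source of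
    smallness. *)
Lemma wnorm_solve (rho Y1 Y2 : R) b w f N  (A B : R) : 0 < rho -> Y1 != 0 ->
  A = rho * `|Y1| -> B = rho * `|Y2| ->
  wnorm A B N (solve_series Y1 Y2 b w f) <=
    `|w| + A * (\sum_(n < N) `|b n| * rho ^+ n) + 2 * B * wnorm A B N f.
Proof.
move=> r0 Y0 AE BE.
have A0 : 0 <= A by rewrite AE mulr_ge0 // ltW.
have B0 : 0 <= B by rewrite BE mulr_ge0 // ltW.
have W0 i j : 0 <= `|f i j| * A ^+ i * B ^+ j by rewrite !mulr_ge0 ?exprn_ge0.
case: N => [|N].
  by rewrite /wnorm /box !big_ord0 !mulr0 !addr0.
set F := solve_series _ _ _ _ _.
have H1 : \sum_(i < N.+1) \sum_(j < N) `|F i j.+1| * A ^+ i * B ^+ j.+1 <= B * wnorm A B N.+1 f.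
  rewrite mulr_sumr; apply: ler_sum => i _.
  apply: (@le_trans _ _ (B * \sum_(j < N) `|f i j| * A ^+ i * B ^+ j)).
    rewrite mulr_sumr; apply: ler_sum => j _.
    rewrite /F /= normrM normfV normr_nat exprS mulrCA ler_wpM2l //.
    rewrite !ler_wpM2r ?exprn_ge0 // ler_piMr // invf_le1 ?ltr0n //.
    by rewrite ler1n.
  rewrite ler_wpM2l //.
  exact: (ler_sum_widen (F := fun j => `|f i j| * A ^+ i * B ^+ j)).
have H2 : \sum_(n < N) `|F n.+1 0%N| * A ^+ n.+1 <=
    A * (\sum_(n < N.+1) `|b n| * rho ^+ n) + B * wnorm A B N.+1 f.
  apply: (@le_trans _ _ (A * (\sum_(n < N) `|b n| * rho ^+ n) + B *
     \sum_(n < N) \sum_(a < n.+1) `|f a (n - a)%N| * A ^+ a * B ^+ (n - a))).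
    rewrite !mulr_sumr -big_split /=; apply: ler_sum => n _.
    exact: solve_series_axis_le.
  apply: lerD; rewrite ler_wpM2l //.
    apply: (ler_sum_widen (F := fun n => `|b n| * rho ^+ n)) => // n.
    by rewrite mulr_ge0 // exprn_ge0 // ltW.
  apply: le_trans (ler_triangle _ W0) _; exact: ler_box_widen.
have -> : wnorm A B N.+1 F = `|w| + \sum_(n < N) `|F n.+1 0%N| * A ^+ n.+1 +
    \sum_(i < N.+1) \sum_(j < N) `|F i j.+1| * A ^+ i * B ^+ j.+1.
  rewrite /wnorm /box.
  under eq_bigr => i _ do rewrite big_ord_recl /= expr0 mulr1.
  by rewrite big_split /= big_ord_recl /= expr0 mulr1; congr (_ + _ + _).
lra.
Qed.

(* With the unknowns numbered from 0, the system reads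
   [d_2 (u s) = sign_of s * p * u (partner s)] when [d2_prescribed s], and the same with
   [d_1] otherwise. *)
Definition partner (s : nat) : nat := nth 0%N [:: 1; 0; 3; 2]%N s.
Definition sign_of (s : nat) : R := nth 1 [:: 1; -1; 1; -1] s.
Definition d2_prescribed (s : nat) : bool := (s == 0%N) || (s == 3).

Definition potential u i j : R :=
  mul_series (u 0%N) (u 2%N) i j + mul_series (u 1%N) (u 3%N) i j.
Definition rhs u s i j : R := sign_of s * mul_series (potential u) (u (partner s)) i j.

Definition agree n u v := forall s i j, (i + j < n)%N -> u s i j = v s i j.

Lemma mul_series_local c d c' d' n :
  (forall i j, (i + j < n)%N -> c i j = c' i j) -> (forall i j, (i + j < n)%N -> d i j = d' i j) ->
  forall i j, (i + j < n)%N -> mul_series c d i j = mul_series c' d' i j.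
Proof.
move=> cc dd i j ijn; apply: eq_bigr => a _; apply: eq_bigr => b _.
have := ltn_ord a; have := ltn_ord b => *; rewrite cc ?dd //; lia.
Qed.

Lemma rhs_local n u v : agree n u v -> agree n (rhs u) (rhs v).
Proof.
move=> uv s i j ijn; congr (_ * _).
apply: (@mul_series_local _ _ _ _ n) => // k l kl; last exact: uv.
by congr (_ + _); apply: (@mul_series_local _ _ _ _ n) => //; exact: uv.
Qed.

Section Iteration.
Variables (X1 X2 : R) (b : nat -> nat -> R) (w : nat -> R).

Definition picard u s : nat -> nat -> R :=
  if d2_prescribed s then solve_series X1 X2 (b s) (w s) (rhs u s)
  else transpose_series (solve_series X2 X1 (b s) (w s) (transpose_series (rhs u s))).

Lemma picard_local n u v : agree n u v -> agree n.+1 (picard u) (picard v).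
Proof.
move=> /rhs_local uv s i j ijn; rewrite /picard; case: ifP => _.
  by apply: (@solve_series_local _ _ _ _ _ _ n) => // k l; exact: uv.
rewrite /transpose_series; apply: (@solve_series_local _ _ _ _ _ _ n); last by rewrite addnC.
by move=> k l kl; apply: uv; rewrite addnC.
Qed.

Definition picard_iter n : nat -> nat -> nat -> R := iter n picard (fun _ _ _ => 0).

Lemma picard_iter_agree n k : agree n (picard_iter n) (picard_iter (n + k)).
Proof. by elim: n => [//|n IH]; rewrite addSn; apply: picard_local. Qed.

(* The coefficients of degree [n] no longer change after [n + 1] iterations. *)
Definition picard_fix s i j := picard_iter (i + j).+1 s i j.

Lemma picard_fix_agree n : agree n picard_fix (picard_iter n).
Proof.
move=> s i j ijn; rewrite /picard_fix -(subnKC ijn).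
exact: (@picard_iter_agree (i + j).+1 (n - (i + j).+1) s i j).
Qed.

(** Below degree i + j the limit coincides with the iterate of that rank, and [picard] gains one
    degree, which is enough to reach the coefficient (i, j). *)
Lemma picard_fixE s i j : picard_fix s i j = picard picard_fix s i j.
Proof. by rewrite (picard_local (@picard_fix_agree (i + j)) s (ltnSn _)). Qed.

Hypotheses (X10 : X1 != 0) (X20 : X2 != 0).

Definition total_norm (rho : R) N u : R :=
  \sum_(s < 4) wnorm (rho * `|X1|) (rho * `|X2|) N (u s).

Lemma partner_lt s : (s < 4)%N -> (partner s < 4)%N.
Proof. by case: s => [|[|[|[|]]]]. Qed.

Lemma norm_sign_of s : `|sign_of s| = 1.
Proof.
by case: s => [|[|[|[|s]]]]; rewrite /sign_of /= ?nth_nil ?normrN ?normr1.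
Qed.

(** The nonlinearity is a cubic form, hence the cube. Each of the four unknowns contributes at most
    (A1 + A2)(B + 2 T^3) besides its initial value, whichever of the two directions it is integrated
    in. *)
Lemma total_norm_picard rho (B : R) N u : 0 < rho ->
  (forall s, (s < 4)%N -> \sum_(n < N) `|b s n| * rho ^+ n <= B) ->
  total_norm rho N (picard u) <= \sum_(s < 4) `|w s| +
    rho * (`|X1| + `|X2|) * (4 * B + 8 * total_norm rho N u ^+ 3).
Proof.
move=> r0 bB; set T := total_norm _ _ u.
pose A1 := rho * `|X1|; pose A2 := rho * `|X2|.
have A10 : 0 <= A1 by rewrite mulr_ge0 // ltW.
have A20 : 0 <= A2 by rewrite mulr_ge0 // ltW.
have W0 c : 0 <= wnorm A1 A2 N c by exact: wnorm_ge0.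
have uT s : (s < 4)%N -> wnorm A1 A2 N (u s) <= T.
  by move=> s4; rewrite /T /total_norm (bigD1 (Ordinal s4)) //= lerDl sumr_ge0.
have T0 : 0 <= T by apply: sumr_ge0.
have pT : wnorm A1 A2 N (potential u) <= T ^+ 2.
  apply: le_trans (wnormD _ _ _ A10 A20) _.
  have U : wnorm A1 A2 N (u 0%N) + wnorm A1 A2 N (u 1%N) + wnorm A1 A2 N (u 2%N) +
      wnorm A1 A2 N (u 3%N) = T.
    by rewrite /T /total_norm !big_ord_recl big_ord0 addr0 !addrA.
  have := wnorm_mul N (u 0%N) (u 2%N) A10 A20; have := wnorm_mul N (u 1%N) (u 3%N) A10 A20.
  rewrite -U; have := W0 (u 0%N); have := W0 (u 1%N); have := W0 (u 2%N); have := W0 (u 3%N).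
  nra.
have rT s : (s < 4)%N -> wnorm A1 A2 N (rhs u s) <= T ^+ 3.
  move=> s4; rewrite /rhs wnorm_sign ?norm_sign_of //.
  apply: le_trans (wnorm_mul _ _ _ A10 A20) _; rewrite exprSr ler_pM //.
  by apply: uT; exact: partner_lt.
have sB s : (s < 4)%N -> 0 <= \sum_(n < N) `|b s n| * rho ^+ n.
  by move=> _; apply: sumr_ge0 => n _; rewrite mulr_ge0 // exprn_ge0 // ltW.
have H s : (s < 4)%N -> wnorm A1 A2 N (picard u s) <= `|w s| + (A1 + A2) * (B + 2 * T ^+ 3).
  move=> s4; have := rT _ s4; have := bB _ s4; have := sB _ s4.
  have T30 : 0 <= T ^+ 3 by rewrite exprn_ge0.
  rewrite /picard; case: ifP => _ S0 SB RT.
    apply: le_trans (wnorm_solve (b s) (w s) (rhs u s) N r0 X10 erefl erefl) _.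
    have := W0 (rhs u s); rewrite -/A1 -/A2; nra.
  rewrite wnorm_transpose.
  apply: le_trans (wnorm_solve (b s) (w s) _ N r0 X20 erefl erefl) _.
  rewrite wnorm_transpose; have := W0 (rhs u s); rewrite -/A1 -/A2; nra.
apply: (@le_trans _ _ (\sum_(s < 4) (`|w s| + (A1 + A2) * (B + 2 * T ^+ 3)))).
  by apply: ler_sum => s _; exact: H.
rewrite big_split /= sumr_const card_ord lerD2l -mulr_natl /A1 /A2 le_eqVlt.
by apply/orP; left; apply/eqP; ring.
Qed.

Lemma geom_weighted_le (c : nat -> R) r M rho N : 0 < rho -> rho <= r / 2 ->
  (forall n, `|c n| * r ^+ n <= M) -> \sum_(n < N) `|c n| * rho ^+ n <= 2 * M.
Proof.
move=> r0 rr cM.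
have M0 : 0 <= M by have := cM 0%N; rewrite expr0 mulr1; apply: le_trans.
have h01 : 0 <= (2^-1 : R) < 1 by lra.
have half : (1 - 2^-1 : R)^-1 = 2 by field.
apply: (@le_trans _ _ (M * \sum_(n < N) 2^-1 ^+ n)); last first.
  by have := geom_sum_le N h01; rewrite half => H; rewrite mulrC ler_wpM2r.
rewrite mulr_sumr; apply: ler_sum => n _.
apply: (@le_trans _ _ (`|c n| * (r / 2) ^+ n)).
  by rewrite ler_wpM2l // lerXn2r ?nnegrE //; lra.
by rewrite exprMn mulrA ler_wpM2r // exprn_ge0.
Qed.

(** The iterates stay in the ball of radius 2 D for a rho that does not depend on the truncation.
    Every coefficient of [picard_fix] belongs to some iterate, so that the bound passes to the limit
    without any convergence argument. *)
Lemma picard_fix_bound r M : 0 < r -> (forall s n, (s < 4)%N -> `|b s n| * r ^+ n <= M) ->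
  exists rho M', 0 < rho /\ forall s, (s < 4)%N -> coef_bound (picard_fix s) rho M'.
Proof.
move=> r0 bM.
have M0 : 0 <= M by have := bM 0%N 0%N isT; rewrite expr0 mulr1; apply: le_trans.
pose X := `|X1| + `|X2|; pose D := \sum_(s < 4) `|w s| + 1.
have w0 : 0 <= \sum_(s < 4) `|w s| by apply: sumr_ge0.
have D0 : 1 <= D by rewrite lerDr.
have X10' : 0 < `|X1| by rewrite normr_gt0.
have X20' : 0 < `|X2| by rewrite normr_gt0.
have X0 : 0 < X by rewrite addr_gt0.
(* 8 M + 64 D^3 is the last factor in [total_norm_picard] for B = 2 M and a norm equal to 2 D. With
   rho K <= 1 the next iterate has norm at most D; adding 1 makes K positive in all cases. *)
pose K := X * (8 * M + 64 * D ^+ 3) + 1.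
have K1 : 1 <= K by rewrite lerDr mulr_ge0 ?addr_ge0 ?mulr_ge0 ?exprn_ge0 //; lra.
pose rho := Num.min (r / 2) K^-1.
have K0 : 0 < K by lra.
have rho0 : 0 < rho by rewrite lt_min invr_gt0 K0 divr_gt0.
have rhor : rho <= r / 2 by rewrite ge_min lexx.
have rhoK : rho * K <= 1 by rewrite -ler_pdivlMr // div1r ge_min lexx orbT.
have T2D n N : total_norm rho N (picard_iter n) <= 2 * D.
  elim: n => [|n IH].
    rewrite /total_norm big1 => [|s _]; first lra.
    by apply: big1 => i _; apply: big1 => j _; rewrite normr0 !mul0r.
  have T0 : 0 <= total_norm rho N (picard_iter n).
    by apply: sumr_ge0 => s _; rewrite wnorm_ge0 // mulr_ge0 // ltW.
  apply: le_trans (@total_norm_picard rho (2 * M) N (picard_iter n) rho0 _) _.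
    by move=> s s4; apply: geom_weighted_le rhor _ => // k; exact: bM.
  have T3 : total_norm rho N (picard_iter n) ^+ 3 <= (2 * D) ^+ 3.
    by rewrite lerXn2r ?nnegrE //; lra.
  have : rho * X * (4 * (2 * M) + 8 * total_norm rho N (picard_iter n) ^+ 3) <= rho * K.
    rewrite -mulrA ler_wpM2l ?(ltW rho0) // /K.
    apply: (@le_trans _ _ (X * (8 * M + 64 * D ^+ 3))); last lra.
    rewrite ler_wpM2l ?(ltW X0) //; move: T3; rewrite exprMn; lra.
  rewrite -/X /D in D0 *; lra.
(* [coef_bound] uses one radius for both variables: the smaller of the two weights. *)
pose m := Num.min `|X1| `|X2|.
have m0 : 0 < m by rewrite lt_min X10' X20'.
exists (rho * m), (2 * D); split; first by rewrite mulr_gt0.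
move=> s s4 i j; set n := (i + j).+1.
have A0 X' : 0 <= rho * `|X'| by rewrite mulr_ge0 // ltW.
have P0 k l : 0 <= `|picard_iter n s k l| * (rho * `|X1|) ^+ k * (rho * `|X2|) ^+ l.
  by rewrite !mulr_ge0 ?exprn_ge0.
apply: le_trans (T2D n n).
apply: (@le_trans _ _ (wnorm (rho * `|X1|) (rho * `|X2|) n (picard_iter n s))).
  have := @ler_term_box _ n (fun i j => `|picard_iter n s i j| * (rho * `|X1|) ^+ i *
    (rho * `|X2|) ^+ j) i j P0.
  rewrite !ltnS leq_addr leq_addl => /(_ isT isT); apply: le_trans.
  rewrite /picard_fix exprD -mulrA ler_wpM2l // ler_pM ?exprn_ge0 ?mulr_ge0
    ?(ltW rho0) ?(ltW m0) //.
    by rewrite lerXn2r ?nnegrE ?mulr_ge0 ?(ltW rho0) ?(ltW m0) // ler_wpM2l ?(ltW rho0) //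
      ge_min lexx.
  by rewrite lerXn2r ?nnegrE ?mulr_ge0 ?(ltW rho0) ?(ltW m0) // ler_wpM2l ?(ltW rho0) //
      ge_min lexx orbT.
rewrite /total_norm (bigD1 (Ordinal s4)) //= lerDl sumr_ge0 // => k _; exact: wnorm_ge0.
Qed.

Lemma picard_fix0 s : picard_fix s 0 0 = w s.
Proof. by rewrite picard_fixE /picard; case: ifP. Qed.

Lemma picard_fix_d2 s i j : d2_prescribed s ->
  j.+1%:R * picard_fix s i j.+1 = rhs picard_fix s i j.
Proof. by move=> s2; rewrite picard_fixE /picard s2 solve_series_d2. Qed.

Lemma picard_fix_d1 s i j : ~~ d2_prescribed s ->
  i.+1%:R * picard_fix s i.+1 j = rhs picard_fix s i j.
Proof.
by move=> s2; rewrite picard_fixE /picard (negbTE s2) /transpose_series solve_series_d2.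
Qed.

Lemma picard_fix_line1 s n : d2_prescribed s ->
  \sum_(k < n.+1) k.+1%:R * picard_fix s k.+1 (n - k)%N * X1 ^+ k * X2 ^+ (n - k) = b s n.
Proof.
move=> s2; rewrite -(solve_series_line X2 (b s) (w s) (rhs picard_fix s) n X10).
by apply: eq_bigr => k _; rewrite picard_fixE /picard s2.
Qed.

Lemma picard_fix_line2 s n : ~~ d2_prescribed s ->
  \sum_(k < n.+1) k.+1%:R * picard_fix s (n - k)%N k.+1 * X2 ^+ k * X1 ^+ (n - k) = b s n.
Proof.
move=> s2; rewrite -(solve_series_line X1 (b s) (w s) (transpose_series (rhs picard_fix s)) n X20).
by apply: eq_bigr => k _; rewrite picard_fixE /picard (negbTE s2).
Qed.

End Iteration.

End FormalSolution.

(** * Pull-back of the forms to a graph, and restriction of a germ to a line *)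

Section IntegralSurfaces.
Local Open Scope classical_set_scope.
Local Open Scope ring_scope.
Context {R : realType}.
Implicit Types (f g : 'rV[R]_2 -> R) (c : nat -> nat -> R).

Lemma is_derive_coord n (x v : 'rV[R]_n) i : is_derive x v (fun y : 'rV[R]_n => y 0 i) (v 0 i).
Proof.
apply: (@is_derive_quadratic _ _ _ _ _ _ 0 1) => // h _.
by rewrite !mxE mul0r addrK subrr normr0.
Qed.

(** The derivative of the graph is one vector, computed coordinate by coordinate once the whole
    graph is derivable; this is where the derivability of xi enters, although no d xi^r occurs in
    the forms. *)
Lemma omega_graph m q (G : 'rV[R]_(2 + m + q) -> 'M[R]_(q, 2))
    (xi : 'rV[R]_2 -> 'rV[R]_m) (u : 'rV[R]_2 -> 'rV[R]_q) (x v : 'rV[R]_2) s :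
  (forall r, derivable (fun y => xi y 0 r : R) x v) ->
  (forall s, derivable (fun y => u y 0 s : R) x v) ->
  omega G s (graph_point x (xi x) (u x)) ('D_v (fun y => graph_point y (xi y) (u y)) x) =
  'D_v (fun y => u y 0 s) x - \sum_mu G (graph_point x (xi x) (u x)) s mu * v 0 mu.
Proof.
move=> dxi du; set graph := fun y => _.
have gx y mu : graph y 0 (lshift q (lshift m mu)) = y 0 mu.
  by rewrite /graph /graph_point !row_mxEl.
have gxi y r : graph y 0 (lshift q (rshift 2 r)) = xi y 0 r.
  by rewrite /graph /graph_point row_mxEl row_mxEr.
have gu y k : graph y 0 (rshift (2 + m) k) = u y 0 k.
  by rewrite /graph /graph_point row_mxEr.
have dg : derivable graph x v.
  apply/derivable_mxP => i j; rewrite (ord1 i).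
  case: (splitP j) => [j1 E|k E]; last first.
    have -> : j = rshift (2 + m) k by apply: val_inj => /=; rewrite E.
    by under eq_fun do rewrite gu; exact: du.
  have -> : j = lshift q j1 by apply: val_inj => /=; rewrite E.
  case: (splitP j1) => [mu E1|r E1].
    have -> : j1 = lshift m mu by apply: val_inj => /=; rewrite E1.
    by under eq_fun do rewrite gx; apply: ex_derive; exact: is_derive_coord.
  have -> : j1 = rshift 2 r by apply: val_inj => /=; rewrite E1.
  by under eq_fun do rewrite gxi; exact: dxi.
rewrite /omega (derive_mx dg); congr (_ - _).
  rewrite !mxE; congr ('D_v _ x); apply/funext => y; exact: gu.
apply: eq_bigr => mu _; congr (_ * _); rewrite !mxE.
under eq_fun do rewrite gx.
by have [_] := is_derive_coord x v mu.
Qed.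

Lemma germ_nearP f (a : 'rV[R]_2) c rho M : germ f a c rho M ->
  \forall x \near a, analytic_at f x /\ forall v : 'rV[R]_2, is_derive x v f
    (ev (shift_series c 1 0) a x * v 0 0 + ev (shift_series c 0 1) a x * v 0 1).
Proof.
move=> g; have [r0 _ _] := g; have r4 : 0 < rho / 4 by rewrite divr_gt0.
by apply: filterS (near_norm a r4) => x; apply: (germ_near g).
Qed.

Lemma germ_eq_near f g a c rho M rho' M' : germ f a c rho M -> germ g a c rho' M' ->
  \forall x \near a, f x = g x.
Proof.
move=> gf gg; have [r0 _ _] := gf; have [r0' _ _] := gg.
by near=> x; apply: (germ_unique gf gg); near: x; exact: near_norm.
Unshelve. all: by end_near. Qed.

Lemma analytic_at_derivable (f : 'rV[R]_2 -> R) x v : analytic_at f x -> derivable f x v.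
Proof. by move=> /analytic_at2P[c [rho [M g]]]; case: (germ_is_derive v g). Qed.

Lemma shift_series10 c i j : shift_series c 1 0 i j = i.+1%:R * c i.+1 j :> R.
Proof. by rewrite /shift_series bin0 bin1 mulr1n mulr_natl add1n. Qed.

Lemma shift_series01 c i j : shift_series c 0 1 i j = j.+1%:R * c i j.+1 :> R.
Proof. by rewrite /shift_series bin0 bin1 mulr1n mulr_natl add1n. Qed.

Lemma near0_norm (r : R) : 0 < r -> \forall t \near (0 : R), `|t| < r.
Proof. by move=> r0; apply: (@nbhs0_lt R R^o). Qed.

(** Substituting (t X^1, t X^2) and grouping by total degree gives the same partial sums as the
    series of [phi]; both have limits, which are therefore equal. *)
Lemma germ_line f (a : 'rV[R]_2) c rho M (b : nat -> R) phi r (X : 'rV[R]_2) :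
  germ f a c rho M -> 0 < r ->
  (forall t, `|t| < r -> (fun N => \sum_(n < N) b n * t ^+ n) @ \oo --> phi t) ->
  (forall n, \sum_(k < n.+1) c k (n - k)%N * X 0 0 ^+ k * X 0 1 ^+ (n - k) = b n) ->
  \forall t \near (0 : R), f (a + t *: X) = phi t.
Proof.
move=> [r0 cM cf] rr bphi cb; have X0 : 0 < `|X| + 1 by rewrite ltr_wpDl.
near=> t.
have tr : `|t| < r by near: t; exact: near0_norm.
have trho : `|t| < rho / (`|X| + 1) by near: t; apply: near0_norm; rewrite divr_gt0.
have tX : `|a + t *: X - a| < rho.
  rewrite addrAC subrr add0r normrZ; apply: (@le_lt_trans _ _ (`|t| * (`|X| + 1))).
    by rewrite ler_wpM2l // lerDl.
  by rewrite -ltr_pdivlMr.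
have [th th01 tth] := norm_ratio r0 tX.
have sf := sums_triangle th01 (term_dominated_norm r0 cM tth) (cf _ tX).
have sphi := cvg_even (bphi t tr).
suff E : (fun K => \sum_(n < K + K) \sum_(k < n.+1)
    term c ((a + t *: X - a) 0 0) ((a + t *: X - a) 0 1) k (n - k)%N) =
    (fun K => \sum_(n < K + K) b n * t ^+ n).
  by rewrite E in sf; rewrite -(cvg_lim _ sf) // (cvg_lim _ sphi).
apply/funext => K; apply: eq_bigr => n _; rewrite -cb mulr_suml; apply: eq_bigr => k _.
rewrite /term addrAC subrr add0r !mxE.
have -> : t ^+ n = t ^+ k * t ^+ (n - k) by rewrite -exprD subnKC // -ltnS.
by rewrite !exprMn; ring.
Unshelve. all: by end_near. Qed.

End IntegralSurfaces.

(** * Existence: from the formal series to an integral surface *)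

Section WeierstrassExistence.
Local Open Scope classical_set_scope.
Local Open Scope ring_scope.
Context {R : realType}.

(* The two coefficients of [dx^1, dx^2] in [du_s - omega_s], with [u_s] and [xi^r] numbered
   from 0. *)
Definition wform (U XI : nat -> R) (s : nat) : R * R :=
  let p := U 0%N * U 2%N + U 1%N * U 3%N in
  let P := U 0%N * XI 2%N + U 3%N * XI 1%N in
  let Pbar := U 2%N * XI 0%N + U 1%N * XI 3%N in
  nth (0, 0)
    [:: (XI 0%N, p * U 1%N);
        (- (p * U 0%N), XI 1%N);
        (p * U 3%N, XI 2%N);
        (XI 3%N, - (p * U 2%N));
        (U 1%N * Pbar - p ^+ 2 * U 0%N, U 1%N * P + p * XI 1%N);
        (- (U 0%N * Pbar + p * XI 0%N), - (U 0%N * P + p ^+ 2 * U 1%N));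
        (U 3%N * Pbar + p * XI 3%N, U 3%N * P - p ^+ 2 * U 2%N);
        (- (U 2%N * Pbar + p ^+ 2 * U 3%N), - (U 2%N * P + p * XI 2%N))] s.

Lemma weierstrassE (x : 'rV[R]_2) (xi : 'rV[R]_4) (u : 'rV[R]_8) s mu :
  weierstrass (graph_point x xi u) s mu =
  (if mu == 0 then (wform (fun k => u 0 (inord k)) (fun k => xi 0 (inord k)) s).1
   else (wform (fun k => u 0 (inord k)) (fun k => xi 0 (inord k)) s).2).
Proof.
by rewrite mxE /upart /xipart /graph_point row_mxKr row_mxKl row_mxKr.
Qed.

Lemma wform_low U XI (s : nat) : (s < 4)%N ->
  let p := U 0%N * U 2%N + U 1%N * U 3%N in
  wform U XI s = if d2_prescribed s then (XI s, sign_of s * (p * U (partner s)))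
                 else (sign_of s * (p * U (partner s)), XI s).
Proof.
by case: s => [|[|[|[|]]]] // _; rewrite /wform /sign_of /= ?mul1r ?mulN1r.
Qed.

(** The product rule applied to [sign_of s * (p * U (partner s))], with the first four equations
    supplying the derivatives [d1] and [d2] of the factors. *)
Lemma wform_high U XI (s : nat) : (s < 4)%N ->
  let p := U 0%N * U 2%N + U 1%N * U 3%N in
  let d1 k := (wform U XI k).1 in let d2 k := (wform U XI k).2 in
  wform U XI (4 + s) =
    (sign_of s * ((d1 0%N * U 2%N + U 0%N * d1 2%N + (d1 1%N * U 3%N + U 1%N * d1 3%N)) *
       U (partner s) + p * d1 (partner s)),
     sign_of s * ((d2 0%N * U 2%N + U 0%N * d2 2%N + (d2 1%N * U 3%N + U 1%N * d2 3%N)) *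
       U (partner s) + p * d2 (partner s))).
Proof.
by case: s => [|[|[|[|]]]] // _; rewrite /wform /sign_of /=; congr pair; ring.
Qed.

Lemma weierstrass_omega (xi : 'rV[R]_2 -> 'rV[R]_4) (u : 'rV[R]_2 -> 'rV[R]_8)
    (x v : 'rV[R]_2) (s : 'I_8) :
  (forall r, derivable (fun y => xi y 0 r) x v) ->
  (forall s, derivable (fun y => u y 0 s) x v) ->
  let c := wform (fun k => u x 0 (inord k)) (fun k => xi x 0 (inord k)) s in
  omega (@weierstrass R) s (graph_point x (xi x) (u x))
    ('D_v (fun y => graph_point y (xi y) (u y)) x) = 0 <->
  'D_v (fun y => u y 0 s) x = c.1 * v 0 0 + c.2 * v 0 1.
Proof.
move=> dxi du c; rewrite omega_graph // big_ord2 !weierstrassE /= -/c.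
by split => [/eqP|->]; rewrite ?subrr // subr_eq0 => /eqP.
Qed.

Lemma near_all (T : topologicalType) n (a : T) (P : 'I_n -> T -> Prop) :
  (forall s, \forall x \near a, P s x) -> \forall x \near a, forall s, P s x.
Proof. exact: filter_forall. Qed.

Lemma common_radius n (b : 'I_n -> nat -> R) (phi : 'I_n -> R -> R) :
  (forall s, exists rho M, [/\ 0 < rho, forall k, `|b s k| * rho ^+ k <= M &
     forall t, `|t| < rho -> (fun N => \sum_(k < N) b s k * t ^+ k) @ \oo --> phi s t]) ->
  exists rho M, [/\ 0 < rho, forall s k, `|b s k| * rho ^+ k <= M &
     forall s t, `|t| < rho -> (fun N => \sum_(k < N) b s k * t ^+ k) @ \oo --> phi s t].
Proof.
move=> /choice[rho /choice[M H]].
exists (\big[Num.min/1]_s rho s), (\sum_s `|M s|); split.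
- by apply/bigmin_gtP; split => // s _; case: (H s).
- move=> s k; case: (H s) => r0 bM _.
  apply: le_trans (_ : M s <= _); last first.
    by apply: le_trans (ler_norm _) _; rewrite (bigD1 s) //= lerDl sumr_ge0.
  apply: le_trans (bM k); rewrite ler_wpM2l // lerXn2r ?nnegrE ?(ltW r0) //.
    by apply/bigmin_geP; split => // s' _; case: (H s') => /ltW.
  exact: bigmin_le_cond.
- move=> s t tr; case: (H s) => _ _; apply; apply: lt_le_trans tr _; exact: bigmin_le_cond.
Qed.

Lemma is_derive_mulr (f g : 'rV[R]_2 -> R) (x v : 'rV[R]_2) df dg :
  is_derive x v f df -> is_derive x v g dg ->
  is_derive x v (fun y => f y * g y) (df * g x + f x * dg).
Proof.
move=> Df Dg; have := is_deriveM Df Dg.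
by rewrite /GRing.scale /= addrC [g x * _]mulrC.
Qed.

Lemma is_derive_addr (f g : 'rV[R]_2 -> R) (x v : 'rV[R]_2) df dg :
  is_derive x v f df -> is_derive x v g dg ->
  is_derive x v (fun y => f y + g y) (df + dg).
Proof. exact: is_deriveD. Qed.

Lemma is_derive_scaler k (f : 'rV[R]_2 -> R) (x v : 'rV[R]_2) df :
  is_derive x v f df -> is_derive x v (fun y => k * f y) (k * df).
Proof. by move=> Df; have := is_deriveZ k Df. Qed.

Lemma weierstrass_cauchy_existence (z : 'rV[R]_(2 + 4 + 8)) (X : 'rV[R]_2)
    (phi : 'I_4 -> R -> R) : X 0 0 != 0 -> X 0 1 != 0 ->
  (forall r, analytic1_at (phi r) 0) ->
  exists xi u, solves_cauchy (@weierstrass R) z X phi xi u.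
Proof.
move=> X0 X1 aphi.
have [b /common_radius[r [Mb [r0 bM bphi]]]] := choice (fun s => analytic1_atP (aphi s)).
rewrite /solves_cauchy; move: (xpart z) (upart z) => a uz; pose w s := uz 0 (inord s).
pose c := picard_fix (X 0 0) (X 0 1) (fun s => b (inord s)) w.
have [rho [M [rho0 cM]]] : exists rho M, 0 < rho /\
    forall s, (s < 4)%N -> coef_bound (c s) rho M.
  by apply: (picard_fix_bound w X0 X1 r0) => s n _; exact: bM.
pose U s := ev (c s) a.
pose D1 s := ev (shift_series (c s) 1 0) a; pose D2 s := ev (shift_series (c s) 0 1) a.
pose XI s := if d2_prescribed s then D1 s else D2 s.
pose F s x := sign_of s * ((U 0%N x * U 2%N x + U 1%N x * U 3%N x) * U (partner s) x).
(* The constant of integration that gives u_5, ..., u_8 their prescribed values at [a]. *)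
pose k s := w (4 + s)%N - F s a.
pose V s x := F s x + k s.
have Va s : V s a = w (4 + s)%N by rewrite /V /k; move: (F s a) => y; rewrite addrC subrK.
have rho20 : 0 < rho / 2 by rewrite divr_gt0.
have gU s : (s < 4)%N -> germ (U s) a (c s) rho M by move=> s4; apply: germ_ev => //; exact: cM.
have gD1 s : (s < 4)%N -> germ (D1 s) a (shift_series (c s) 1 0) (rho / 2) (M * (2 / rho) ^+ 1).
  by move=> s4; apply: germ_ev => //; apply: coef_bound_shift => //; exact: cM.
have gD2 s : (s < 4)%N -> germ (D2 s) a (shift_series (c s) 0 1) (rho / 2) (M * (2 / rho) ^+ 1).
  by move=> s4; apply: germ_ev => //; apply: coef_bound_shift => //; exact: cM.
have [M' gF] : exists M', forall s, (s < 4)%N -> germ (F s) a (rhs c s) (rho / 2 / 2) M'.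
  eexists => s s4.
  have gp := germD (germ_mul (gU 0%N isT) (gU 2%N isT)) (germ_mul (gU 1%N isT) (gU 3%N isT)).
  have gq : germ (U (partner s)) a (c (partner s)) (rho / 2) M.
    by apply: germW (gU _ (partner_lt s4)) => //; rewrite rho20 ler_piMr ?(ltW rho0) //; lra.
  have := germZ (sign_of s) (germ_mul gp gq); rewrite norm_sign_of mul1r; exact.
have eqD2 s : d2_prescribed s -> shift_series (c s) 0 1 = rhs c s.
  move=> s2; apply/funext => i; apply/funext => j; rewrite shift_series01.
  exact: picard_fix_d2.
have eqD1 s : ~~ d2_prescribed s -> shift_series (c s) 1 0 = rhs c s.
  move=> s2; apply/funext => i; apply/funext => j; rewrite shift_series10.
  exact: picard_fix_d1.
have nU : \forall x \near a, forall s : 'I_4, analytic_at (U s) x /\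
    forall v : 'rV[R]_2, is_derive x v (U s) (D1 s x * v 0 0 + D2 s x * v 0 1).
  by apply: near_all => s; exact: (germ_nearP (gU s (ltn_ord s))).
have nXI : \forall x \near a, forall s : 'I_4, analytic_at (XI s) x.
  apply: near_all => s; rewrite /XI; case: ifP => _.
    by apply: filterS (germ_nearP (gD1 s (ltn_ord s))) => x [].
  by apply: filterS (germ_nearP (gD2 s (ltn_ord s))) => x [].
have nV : \forall x \near a, forall s : 'I_4, analytic_at (V s) x.
  apply: near_all => s.
  have := germD (gF s (ltn_ord s)) (germ_cst (k s) a (divr_gt0 rho20 (ltr0n R 2))).
  by move/germ_nearP; apply: filterS => x [].
(* The formal equations become equations between functions: both sides are germs with the same
   coefficients, on possibly different radii. *)
have nF : \forall x \near a, forall s : 'I_4, (if d2_prescribed s then D2 s x else D1 s x) = F s x.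
  apply: near_all => s; have [s2|s2] := boolP (d2_prescribed s).
    have := gD2 s (ltn_ord s); rewrite eqD2 // => g.
    exact: (germ_eq_near g (gF s (ltn_ord s))).
  have := gD1 s (ltn_ord s); rewrite eqD1 // => g.
  exact: (germ_eq_near g (gF s (ltn_ord s))).
pose xf x : 'rV[R]_4 := \row_r XI r x.
pose uf x : 'rV[R]_8 := \row_s if (s < 4)%N then U s x else V (s - 4)%N x.
exists xf, uf; split.
- near=> x.
  have aU : forall s : 'I_4, analytic_at (U s) x /\
    forall v : 'rV[R]_2, is_derive x v (U s) (D1 s x * v 0 0 + D2 s x * v 0 1) by near: x.
  have aXI : forall s : 'I_4, analytic_at (XI s) x by near: x.
  have aV : forall s : 'I_4, analytic_at (V s) x by near: x.
  have FE : forall s : 'I_4, (if d2_prescribed s then D2 s x else D1 s x) = F s x by near: x.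
  have axi i : analytic_at (fun y => xf y 0 i) x.
    by rewrite /xf; under eq_fun do rewrite mxE.
  have au (i : 'I_8) : analytic_at (fun y => uf y 0 i) x.
    rewrite /uf; under eq_fun do rewrite mxE; have [i4|i4] := boolP (i < 4)%N.
      by case: (aU (Ordinal i4)).
    have i44 : (i - 4 < 4)%N by have := ltn_ord i; lia.
    exact: (aV (Ordinal i44)).
  split => // s v; apply/weierstrass_omega.
  + by move=> i; exact: analytic_at_derivable.
  + by move=> i; exact: analytic_at_derivable.
  set UU := fun k => uf x 0 (inord k); set XX := fun k => xf x 0 (inord k).
  have UE l : (l < 4)%N -> UU l = U l x.
    by move=> l4; rewrite /UU /uf mxE inordK ?l4 // (leq_trans l4).
  have XE l : (l < 4)%N -> XX l = XI l x.
    by move=> l4; rewrite /XX /xf mxE inordK.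
  have lowE l : (l < 4)%N -> wform UU XX l = (D1 l x, D2 l x).
    move=> l4; rewrite wform_low // !UE ?partner_lt // XE //.
    have := FE (Ordinal l4); rewrite /= /XI /F; case: ifP => _ <- //.
  under eq_fun do rewrite /uf mxE.
  have [s4|s4] := boolP (s < 4)%N.
    rewrite lowE //=; by have [_ /(_ v)[_ ->]] := aU (Ordinal s4).
  have s44 : (s - 4 < 4)%N by have := ltn_ord s; lia.
  have dU l : (l < 4)%N -> is_derive x v (U l) (D1 l x * v 0 0 + D2 l x * v 0 1).
    by move=> l4; have [_] := aU (Ordinal l4).
  have E4 : (s = 4 + (s - 4) :> nat)%N by rewrite subnKC // leqNgt.
  rewrite [X in wform _ _ X]E4 wform_high // !lowE ?partner_lt // !UE ?partner_lt //=.
  have DV := is_derive_addr (is_derive_scaler (sign_of (s - 4)) (is_derive_mulr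
    (is_derive_addr (is_derive_mulr (dU 0%N isT) (dU 2%N isT))
                    (is_derive_mulr (dU 1%N isT) (dU 3%N isT)))
    (dU _ (partner_lt s44)))) (is_derive_cst (k (s - 4)%N) x v).
  case: DV => _ DV; transitivity ('D_v (V (s - 4)%N) x); first by [].
  rewrite DV; clear.
  move: (U 0%N x) (U 1%N x) (U 2%N x) (U 3%N x) (U (partner _) x) (D1 0%N x) (D1 1%N x)
    (D1 2%N x) (D1 3%N x) (D1 (partner _) x) (D2 0%N x) (D2 1%N x) (D2 2%N x) (D2 3%N x)
    (D2 (partner _) x) => *; ring.
- apply/rowP => i; rewrite /uf mxE; case: ifPn => i4.
    rewrite (germ_at_center (gU i i4)) /c picard_fix0 /w.
    by rewrite inord_val.
  rewrite Va.
  have i44 : (4 + (i - 4) = i)%N by rewrite subnKC // leqNgt.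
  by rewrite /w i44 inord_val.
- have nphi : \forall t \near (0 : R), forall s : 'I_4, XI s (a + t *: X) = phi s t.
    apply: near_all => s; rewrite /XI; case: ifPn => s2.
      apply: (germ_line (gD1 s (ltn_ord s)) r0 (bphi s)) => n.
      have := picard_fix_line1 (X 0 1) (fun s => b (inord s)) w X0 n s2; rewrite inord_val => <-.
      by apply: eq_bigr => l _; rewrite shift_series10.
    apply: (germ_line (gD2 s (ltn_ord s)) r0 (bphi s)) => n.
    have := picard_fix_line2 (X 0 0) (fun s => b (inord s)) w X1 n s2; rewrite inord_val => <-.
    (* [picard_fix_line2] is indexed by the power of the second variable and [germ_line] by that of
       the first; the sum has to be reversed. *)
    rewrite (reindex_inj rev_ord_inj) /=; apply: eq_bigr => l _.
    have ln : (l <= n)%N by rewrite -ltnS.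
    by rewrite shift_series01 /= subSS (subKn ln) mulrAC.
  by apply: filterS nphi => t H r'; rewrite /xf mxE; exact: H.
Unshelve. all: by end_near. Qed.

End WeierstrassExistence.

(** * Uniqueness: contraction on a small box *)

Section WeierstrassUniqueness.
Local Open Scope classical_set_scope.
Local Open Scope ring_scope.
Context {R : realType}.

Lemma is_derive_line (f : 'rV[R]_2 -> R) (y v : 'rV[R]_2) (t l : R) :
  is_derive (y + t *: v) v f l -> is_derive t 1 (fun t => f (y + t *: v)) l.
Proof.
have E : (fun h : R =>
      h^-1 *: (((fun t => f (y + t *: v)) \o shift t) (h *: (1 : R)) - f (y + t *: v)))
    = (fun h : R => h^-1 *: ((f \o shift (y + t *: v)) (h *: v) - f (y + t *: v))).
  apply/funext => h; congr (_ *: (f _ - _)).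
  by rewrite /shift /= scalerDl [h *: 1]mulr1 addrCA.
by case=> d dl; split; [rewrite /derivable E | rewrite /derive E].
Qed.

Lemma segment_bound (f : 'rV[R]_2 -> R) (y v : 'rV[R]_2) (l : R -> R) C :
  (forall t : R, 0 <= t <= 1 -> is_derive (y + t *: v) v f (l t)) ->
  (forall t : R, 0 <= t <= 1 -> `|l t| <= C) -> `|f (y + v) - f y| <= C.
Proof.
move=> df lC.
have dg (t : R) : t \in `[0, 1] -> is_derive t 1 (fun t => f (y + t *: v)) (l t).
  by rewrite in_itv /= => t01; apply: is_derive_line; exact: df.
have cg : {within `[0, 1], continuous (fun t => f (y + t *: v))}.
  by apply: derivable_within_continuous => t /dg[].
have dg' (t : R) : t \in `]0, 1[ -> is_derive t 1 (fun t => f (y + t *: v)) (l t).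
  by move/subset_itv_oo_cc; exact: dg.
have [c c01] := MVT_segment ler01 dg' cg.
rewrite scale1r scale0r addr0 subr0 mulr1 => ->; apply: lC.
by move: c01; rewrite in_itv.
Qed.

Lemma prod3_diff (K B a b c a' b' c' : R) : 0 <= B ->
  `|b| <= K -> `|c| <= K -> `|a'| <= K -> `|b'| <= K ->
  `|a - a'| <= B -> `|b - b'| <= B -> `|c - c'| <= B ->
  `|a * b * c - a' * b' * c'| <= 3 * K ^+ 2 * B.
Proof.
move=> B0 bK cK aK' bK' aB bB cB.
have -> : a * b * c - a' * b' * c' =
    (a - a') * (b * c) + (b - b') * (a' * c) + (c - c') * (a' * b').
  by ring.
have H (x y z : R) : `|x| <= B -> `|y| <= K -> `|z| <= K -> `|x * (y * z)| <= B * (K * K).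
  by move=> xB yK zK; rewrite !normrM !ler_pM ?mulr_ge0.
apply: le_trans (ler_normD _ _) _; apply: le_trans (lerD (ler_normD _ _) (lexx _)) _.
have := H _ _ _ aB bK cK; have := H _ _ _ bB aK' cK; have := H _ _ _ cB aK' bK'.
rewrite expr2; lra.
Qed.

(** All that the uniqueness argument keeps of analyticity: on one common ball, u is bounded and has
    the directional derivatives dictated by the forms. *)
Lemma solution_is_derive (xi : 'rV[R]_2 -> 'rV[R]_4) (u : 'rV[R]_2 -> 'rV[R]_8) (a : 'rV[R]_2) :
  analytic_solution_at (@weierstrass R) a xi u ->
  exists (r K : R), [/\ 0 < r, 0 <= K,
    forall x s, `|x - a| < r -> `|u x 0 s| <= K &
    forall x (s : 'I_8) (v : 'rV[R]_2), `|x - a| < r ->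
      let c := wform (fun k => u x 0 (inord k)) (fun k => xi x 0 (inord k)) s in
      is_derive x v (fun y => u y 0 s) (c.1 * v 0 0 + c.2 * v 0 1)].
Proof.
move=> sol.
have [r1 r10 H1] := near_normP sol.
have bd (s : 'I_8) : exists rK : R * R, [/\ 0 < rK.1, 0 <= rK.2 &
    forall x, `|x - a| < rK.1 -> `|u x 0 s| <= rK.2].
  have [|_ /(_ s) + _] := H1 a; first by rewrite subrr normr0.
  move=> /analytic_at2P[c [rho [M g]]]; have [r0 cM _] := g.
  exists (rho / 2, M * 4); split => /=; rewrite ?divr_gt0 ?mulr_ge0 ?(coef_bound_ge0 cM) //.
  by move=> x xr; apply: (germ_bounded g); exact: ltW.
have [rK H2] := choice bd.
exists (\big[Num.min/r1]_s (rK s).1), (\sum_s (rK s).2); split.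
- by apply/bigmin_gtP; split => // s _; case: (H2 s).
- by apply: sumr_ge0 => s _; case: (H2 s).
- move=> x s xr; apply: (@le_trans _ _ (rK s).2).
    by case: (H2 s) => _ _; apply; apply: lt_le_trans xr _; exact: bigmin_le_cond.
  by rewrite (bigD1 s) //= lerDl sumr_ge0 // => k _; case: (H2 k).
- move=> x s v xr c.
  have [|axi au om] := H1 x; first by apply: lt_le_trans xr _; exact: bigmin_le_id.
  have dxi i : derivable (fun y => xi y 0 i) x v by exact: analytic_at_derivable.
  have du i : derivable (fun y => u y 0 i) x v by exact: analytic_at_derivable.
  by split => //; apply/(weierstrass_omega s dxi du); exact: om.
Qed.

Lemma halving_eq0 (x c : R) : (forall n : nat, `|x| <= c * 2^-1 ^+ n) -> x = 0.
Proof.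
move=> H; apply/eqP; rewrite -normr_le0.
have h : `|2^-1 : R| < 1 by rewrite ger0_norm; lra.
have cv := @cvg_geometric R c 2^-1 h.
rewrite -(cvg_lim _ cv) //; apply: limr_ge; first exact: cvgP cv.
by apply: nearW => n; exact: H.
Qed.

Lemma wform_eq (U U' XI XI' : nat -> R) s :
  (forall k, (k < 4)%N -> U k = U' k) -> (forall k, (k < 4)%N -> XI k = XI' k) ->
  wform U XI s = wform U' XI' s.
Proof. by move=> UU XX; rewrite /wform !UU // !XX. Qed.

Section TwoSolutions.
Variables (a X : 'rV[R]_2).
Variables (xi xi' : 'rV[R]_2 -> 'rV[R]_4) (u u' : 'rV[R]_2 -> 'rV[R]_8) (r K : R).
Hypotheses (X0 : X 0 0 != 0) (X1 : X 0 1 != 0) (r0 : 0 < r) (K0 : 0 <= K).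
Hypothesis uK : forall x s, `|x - a| < r -> `|u x 0 s| <= K.
Hypothesis uK' : forall x s, `|x - a| < r -> `|u' x 0 s| <= K.
Let U x k := u x 0 (inord k).
Let U' x k := u' x 0 (inord k).
Let XI x k := xi x 0 (inord k).
Let XI' x k := xi' x 0 (inord k).
Hypothesis du : forall x (s : 'I_8) (v : 'rV[R]_2), `|x - a| < r ->
  let c := wform (U x) (XI x) s in is_derive x v (fun y => u y 0 s) (c.1 * v 0 0 + c.2 * v 0 1).
Hypothesis du' : forall x (s : 'I_8) (v : 'rV[R]_2), `|x - a| < r ->
  let c := wform (U' x) (XI' x) s in
  is_derive x v (fun y => u' y 0 s) (c.1 * v 0 0 + c.2 * v 0 1).
Hypothesis ua : u a = u' a.
Hypothesis xiE : forall t, `|t| < r -> xi (a + t *: X) = xi' (a + t *: X).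

Let e (s : 'I_8) x := u x 0 s - u' x 0 s.

Lemma difference_segment (s : 'I_8) (y v : 'rV[R]_2) C :
  (forall t : R, 0 <= t <= 1 -> `|y + t *: v - a| < r /\
    let c := wform (U (y + t *: v)) (XI (y + t *: v)) s in
    let c' := wform (U' (y + t *: v)) (XI' (y + t *: v)) s in
    `|(c.1 - c'.1) * v 0 0 + (c.2 - c'.2) * v 0 1| <= C) ->
  `|e s (y + v) - e s y| <= C.
Proof.
move=> H; pose c t := wform (U (y + t *: v)) (XI (y + t *: v)) s.
pose c' t := wform (U' (y + t *: v)) (XI' (y + t *: v)) s.
apply: (@segment_bound (e s) y v
  (fun t => (c t).1 * v 0 0 + (c t).2 * v 0 1 - ((c' t).1 * v 0 0 + (c' t).2 * v 0 1))) => t t01.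
  have [tr _] := H t t01; exact: (is_deriveB (du s v tr) (du' s v tr)).
have [_] := H t t01; rewrite /= -/(c t) -/(c' t).
by congr (`|_| <= _); ring.
Qed.

(** Expanding [p] gives two triple products, each contributing 3 K^2 B. *)
Lemma rhs_diff (x : 'rV[R]_2) s B : `|x - a| < r -> 0 <= B -> (s < 4)%N ->
  (forall k, (k < 4)%N -> `|U x k - U' x k| <= B) ->
  `|sign_of s * ((U x 0%N * U x 2%N + U x 1%N * U x 3%N) * U x (partner s)) -
    sign_of s * ((U' x 0%N * U' x 2%N + U' x 1%N * U' x 3%N) * U' x (partner s))|
  <= 6 * K ^+ 2 * B.
Proof.
move=> xr B0 s4 UB; rewrite -mulrBr normrM norm_sign_of mul1r.
have H k : `|U x k| <= K by exact: uK.
have H' k : `|U' x k| <= K by exact: uK'.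
have q4 := partner_lt s4.
have A := prod3_diff B0 (H 2%N) (H (partner s)) (H' 0%N) (H' 2%N)
  (UB 0%N isT) (UB 2%N isT) (UB _ q4).
have A' := prod3_diff B0 (H 3%N) (H (partner s)) (H' 1%N) (H' 3%N)
  (UB 1%N isT) (UB 3%N isT) (UB _ q4).
rewrite !mulrDl opprD addrACA.
apply: le_trans (ler_normD _ _) _; apply: le_trans (lerD A A') _; lra.
Qed.

(* The box is shrunk so that integrating along the prescribed line and then along a
   characteristic divides a bound on the difference of the solutions by 2. *)
Let L := 6 * K ^+ 2 + 1.
Let N := `|X 0 0| + `|X 0 1| + 1.
Let rho := Num.min (r / (2 * N)) (6 * L * N)^-1.
Let D (x : 'rV[R]_2) :=
  `|(x - a) 0 0| <= rho * `|X 0 0| /\ `|(x - a) 0 1| <= rho * `|X 0 1|.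

Let L1 : 1 <= L. Proof. by rewrite lerDr mulr_ge0 // exprn_ge0. Qed.
Let N1 : 1 <= N. Proof. by rewrite lerDr addr_ge0. Qed.
Let rho0 : 0 < rho.
Proof.
have := L1; have := N1 => *.
by rewrite lt_min divr_gt0 ?invr_gt0 ?mulr_gt0 //; lra.
Qed.

Lemma box_in_ball x : D x -> `|x - a| < r.
Proof.
move=> [x0 x1].
have rN : rho * N < r.
  have := N1 => n1; have n0 : 0 < 2 * N by lra.
  have : rho <= r / (2 * N) by rewrite ge_min lexx.
  have := mulr_gt0 rho0 (lt_le_trans ltr01 n1); rewrite ler_pdivlMr //; lra.
have X0N : rho * `|X 0 0| <= rho * N.
  by rewrite ler_wpM2l ?(ltW rho0) // /N -addrA lerDl addr_ge0.
have X1N : rho * `|X 0 1| <= rho * N.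
  by rewrite ler_wpM2l ?(ltW rho0) // /N addrAC lerDr addr_ge0.
apply: norm_mx_lt => // i j; rewrite ord1; case: j => -[|[|//]] j2.
  have -> : Ordinal j2 = 0 by exact: val_inj.
  by apply: le_lt_trans x0 _; lra.
have -> : Ordinal j2 = 1 by exact: val_inj.
by apply: le_lt_trans x1 _; lra.
Qed.

Lemma convex_bound (p q t C : R) : `|p| <= C -> `|q| <= C -> 0 <= t <= 1 ->
  `|p + t * (q - p)| <= C.
Proof.
move=> pC qC /andP[t0 t1].
have -> : p + t * (q - p) = (1 - t) * p + t * q by ring.
apply: le_trans (ler_normD _ _) _; rewrite !normrM (ger0_norm t0) ger0_norm ?subr_ge0 //.
nra.
Qed.

Lemma box_segment x y t : D x -> D y -> 0 <= t <= 1 -> D (y + t *: (x - y)).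
Proof.
move=> [x0 x1] [y0 y1] t01.
have E i : (y + t *: (x - y) - a) 0 i = (y - a) 0 i + t * ((x - a) 0 i - (y - a) 0 i).
  by rewrite !mxE; ring.
by rewrite /D !E; split; apply: convex_bound.
Qed.

Lemma box_center : D a.
Proof. by rewrite /D subrr !mxE normr0 !mulr_ge0 // ltW. Qed.

(** The sides of [D] are proportional to the coordinates of [X], so that the line is a diagonal of
    [D]: every segment of [D] parallel to an axis and joining two opposite sides crosses it. *)
Lemma box_line t : `|t| <= rho -> D (a + t *: X).
Proof. by move=> tr; rewrite /D addrAC subrr add0r !mxE !normrM !ler_wpM2r. Qed.

Lemma rho_lt_r : rho < r.
Proof.
have n1 := N1; have n0 : 0 < 2 * N by lra.
have : rho <= r / (2 * N) by rewrite ge_min lexx.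
rewrite ler_pdivlMr // => H; have : rho * 1 <= rho * N by rewrite ler_wpM2l ?(ltW rho0).
by have := rho0; lra.
Qed.

Lemma box_contraction B : 0 <= B ->
  (forall x k, D x -> (k < 4)%N -> `|U x k - U' x k| <= B) ->
  forall x k, D x -> (k < 4)%N -> `|U x k - U' x k| <= B * 2^-1.
Proof.
move=> B0 UB x k Dx k4; have [x0 x1] := Dx.
pose F y := sign_of k * ((U y 0%N * U y 2%N + U y 1%N * U y 3%N) * U y (partner k)).
pose F' y := sign_of k * ((U' y 0%N * U' y 2%N + U' y 1%N * U' y 3%N) * U' y (partner k)).
have FB y : D y -> `|F y - F' y| <= L * B.
  move=> Dy; apply: le_trans (rhs_diff (box_in_ball Dy) B0 k4 _) _.
    by move=> l l4; exact: UB.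
  by rewrite /L; lra.
have ik : (inord k : 'I_8) = k :> nat by rewrite inordK // (leq_trans k4).
(* 3 = 1 + 2: the coordinate [i] moves by at most rho N from [a] to [y] in [E1], and by at most 2
   rho N from [y] to [x] in [E2]. *)
have small : 3 * rho * N * (L * B) <= B * 2^-1.
  have l1 := L1; have n1 := N1.
  have p : 0 < 6 * L * N by rewrite !mulr_gt0 //; lra.
  have : rho <= (6 * L * N)^-1 by rewrite ge_min lexx orbT.
  rewrite -[(_)^-1]div1r ler_pdivlMr // => H.
  have := ler_wpM2r B0 H; lra.
(* [i] is the direction in which the derivative of [u k] is prescribed, [j] the other one. *)
pose i : 'I_2 := if d2_prescribed k then 1 else 0.
pose j : 'I_2 := if d2_prescribed k then 0 else 1.
have Xj0 : X 0 j != 0 by rewrite /j; case: ifP.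
have XiN : `|X 0 i| <= N.
  have n0 := normr_ge0 (X 0 0); have n1 := normr_ge0 (X 0 1).
  by rewrite /N /i; case: (d2_prescribed k); lra.
have Di (y : 'rV[R]_2) l : D y -> `|(y - a) 0 l| <= rho * `|X 0 l|.
  case=> y0 y1; case: l => -[|[|//]] l2.
    by have -> : Ordinal l2 = 0 by exact: val_inj.
  by have -> : Ordinal l2 = 1 by exact: val_inj.
(* The component of [v] along [j] is multiplied by the difference of the two xi, which is
   uncontrolled off the line. It must vanish either because the xi agree at the point or because the
   segment has no such component. *)
have coef y (v : 'rV[R]_2) : (xi y = xi' y \/ v 0 j = 0) -> D y ->
    let c := wform (U y) (XI y) (inord k : 'I_8) in
    let c' := wform (U' y) (XI' y) (inord k : 'I_8) in
    `|(c.1 - c'.1) * v 0 0 + (c.2 - c'.2) * v 0 1| <= L * B * `|v 0 i|.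
  move=> yv Dy; rewrite /= !ik !wform_low //.
  rewrite /i; move: yv; rewrite /j; case: ifP => k2 /= yv.
    have -> : (XI y k - XI' y k) * v 0 0 = 0.
      by case: yv => [yv|->]; rewrite ?mulr0 // /XI /XI' yv subrr mul0r.
    by rewrite add0r normrM ler_wpM2r //; exact: FB.
  have -> : (XI y k - XI' y k) * v 0 1 = 0.
    by case: yv => [yv|->]; rewrite ?mulr0 // /XI /XI' yv subrr mul0r.
  by rewrite addr0 normrM ler_wpM2r //; exact: FB.
(* The point of the line with the same coordinate [j] as [x]: the characteristic through [x] meets
   the line there. *)
pose t := (x - a) 0 j / X 0 j; pose y := a + t *: X.
have tr : `|t| <= rho.
  by rewrite /t normrM normfV ler_pdivrMr ?normr_gt0 //; exact: Di.
have Dy : D y by exact: box_line.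
have E1 : `|e (inord k) y - e (inord k) a| <= L * B * (rho * N).
  have -> : y = a + (y - a) by rewrite addrC subrK.
  apply: difference_segment => l l01.
  have Dl : D (a + l *: (y - a)) by apply: box_segment => //; exact: box_center.
  split; first exact: box_in_ball.
  apply: le_trans (coef _ _ _ Dl) _.
    left; rewrite /y addrAC subrr add0r scalerA; apply: xiE.
    apply: le_lt_trans _ rho_lt_r; apply: le_trans tr; rewrite normrM ler_piMl //.
    by case/andP: l01 => l0 l1; rewrite ger0_norm.
  apply: ler_wpM2l; first by rewrite mulr_ge0 //; have := L1; lra.
  by apply: le_trans (Di y i Dy) _; rewrite ler_wpM2l // ltW.
have E2 : `|e (inord k) x - e (inord k) y| <= L * B * (2 * rho * N).
  have -> : x = y + (x - y) by rewrite addrC subrK.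
  apply: difference_segment => l l01.
  have Dl : D (y + l *: (x - y)) by exact: box_segment.
  split; first exact: box_in_ball.
  apply: le_trans (coef _ _ _ Dl) _.
    by right; rewrite /y /t !mxE; field.
  apply: ler_wpM2l; first by rewrite mulr_ge0 //; have := L1; lra.
  have -> : (x - y) 0 i = (x - a) 0 i - (y - a) 0 i by rewrite !mxE; ring.
  apply: le_trans (ler_normB _ _) _.
  have := Di x i Dx; have := Di y i Dy.
  have := ler_wpM2l (ltW rho0) XiN; lra.
have e0 : e (inord k) a = 0 by rewrite /e ua subrr.
rewrite e0 subr0 in E1.
change (`|e (inord k) x| <= B * 2^-1).
have -> : e (inord k) x = e (inord k) x - e (inord k) y + e (inord k) y by rewrite subrK.
apply: le_trans (ler_normD _ _) _; lra.
Qed.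

Lemma box_equal x k : D x -> (k < 4)%N -> U x k = U' x k.
Proof.
move=> Dx k4; apply/eqP; rewrite -subr_eq0; apply/eqP; apply: (@halving_eq0 _ (K + K)) => n.
elim: n x k Dx k4 => [|n IH] x k Dx k4.
  rewrite expr0 mulr1; apply: le_trans (ler_normB _ _) _; apply: lerD.
    exact: uK (box_in_ball Dx).
  exact: uK' (box_in_ball Dx).
rewrite exprSr mulrA; apply: box_contraction => //.
by rewrite mulr_ge0 ?addr_ge0 ?exprn_ge0.
Qed.

(** [box_equal] only compares u_1, ..., u_4. Their equality on an open set gives that of their
    derivatives, among which are all the xi. The forms of both solutions then have the same
    coefficients, and integrating from [a] settles the remaining u_s. *)
Lemma solutions_equal : \forall x \near a, xi x = xi' x /\ u x = u' x.
Proof.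
have X00 : 0 < `|X 0 0| by rewrite normr_gt0.
have X10 : 0 < `|X 0 1| by rewrite normr_gt0.
pose d := rho * Num.min `|X 0 0| `|X 0 1|.
have d0 : 0 < d by rewrite mulr_gt0 // lt_min X00 X10.
have bD x : `|x - a| < d -> D x.
  move=> xd; split; apply: le_trans (norm_coord_le _ _ _) _; apply: le_trans (ltW xd) _;
    by rewrite ler_wpM2l ?(ltW rho0) // ge_min lexx ?orbT.
have uE x k : `|x - a| < d -> (k < 4)%N -> U x k = U' x k.
  by move=> /bD Dx k4; exact: box_equal.
have XIE x k : `|x - a| < d -> (k < 4)%N -> XI x k = XI' x k.
  move=> xd k4; have xr := box_in_ball (bD _ xd).
  have ik : (inord k : 'I_8) = k :> nat by rewrite inordK // (leq_trans k4).
  have nx : \forall y \near x, u y 0 (inord k) = u' y 0 (inord k).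
    have dx : 0 < d - `|x - a| by rewrite subr_gt0.
    apply: filterS (near_norm x dx) => y yx; apply: (@uE y k) => //.
    have -> : y - a = (y - x) + (x - a) by rewrite subrKA.
    by apply: le_lt_trans (ler_normD _ _) _; rewrite -ltrBrDr.
  have De (v : 'rV[R]_2) : let c := wform (U x) (XI x) (inord k : 'I_8) in
      let c' := wform (U' x) (XI' x) (inord k : 'I_8) in
      c.1 * v 0 0 + c.2 * v 0 1 = c'.1 * v 0 0 + c'.2 * v 0 1.
    have := near_eq_derive v nx.
    by case: (du (inord k) v xr) => _ ->; case: (du' (inord k) v xr) => _ ->.
  move: (De (delta_mx 0 0)) (De (delta_mx 0 1)).
  rewrite /= !ik !wform_low // !mxE /=; case: ifP => _ /=; rewrite !mulr1 !mulr0 !addr0 !add0r //.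
near=> x.
have xd : `|x - a| < d by near: x; exact: near_norm.
split.
  apply/rowP => i; have := @XIE x i xd (ltn_ord i); by rewrite /XI /XI' inord_val.
apply/rowP => s; apply/eqP; rewrite -subr_eq0.
have ea : e s a = 0 by rewrite /e ua subrr.
rewrite -normr_le0 -/(e s x).
suff : `|e s (a + (x - a)) - e s a| <= 0 by rewrite ea subr0 [a + _]addrC subrK.
apply: difference_segment => t t01.
have Dt : `|a + t *: (x - a) - a| < d.
  rewrite addrAC subrr add0r normrZ; apply: le_lt_trans xd; rewrite ler_piMl //.
  by case/andP: t01 => t0 t1; rewrite ger0_norm.
split; first exact: box_in_ball (bD _ Dt).
rewrite (@wform_eq _ (U' (a + t *: (x - a))) _ (XI' (a + t *: (x - a)))).
- by rewrite /= !subrr !mul0r addr0 normr0.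
- by move=> k k4; exact: uE.
- by move=> k k4; exact: XIE.
Unshelve. all: by end_near. Qed.

End TwoSolutions.

Lemma near0_normP (P : R -> Prop) : (\forall t \near (0 : R), P t) ->
  exists2 r : R, 0 < r & forall t, `|t| < r -> P t.
Proof.
move=> /nbhs_ballP[r /= r0 rP]; exists r => // t tr; apply: rP.
by rewrite /ball /= sub0r normrN.
Qed.

Lemma weierstrass_cauchy_unique (z : 'rV[R]_(2 + 4 + 8)) (X : 'rV[R]_2)
    (phi : 'I_4 -> R -> R) xi u xi' u' : X 0 0 != 0 -> X 0 1 != 0 ->
  solves_cauchy (@weierstrass R) z X phi xi u -> solves_cauchy (@weierstrass R) z X phi xi' u' ->
  \forall x \near xpart z, xi x = xi' x /\ u x = u' x.
Proof.
rewrite /solves_cauchy; move: (xpart z) (upart z) => a uz X0 X1.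
move=> [/solution_is_derive[r [K [r0 K0 uK du]]] ua xiE].
move=> [/solution_is_derive[r' [K' [r0' K0' uK' du']]] ua' xiE'].
have /near0_normP[r'' r0'' xiE''] : \forall t \near (0 : R), xi (a + t *: X) = xi' (a + t *: X).
  near=> t; apply/rowP => i.
  have -> : xi (a + t *: X) 0 i = phi i t by move: i; near: t.
  by have -> : xi' (a + t *: X) 0 i = phi i t by move: i; near: t.
pose rr := Num.min r (Num.min r' r'').
have rr0 : 0 < rr by rewrite !lt_min r0 r0' r0''.
apply: (@solutions_equal a X xi xi' u u' rr (K + K')) => //.
- exact: addr_ge0.
- by move=> x s; rewrite !lt_min => /andP[/uK H _]; apply: le_trans (H s) _; rewrite lerDl.
- by move=> x s; rewrite !lt_min => /and3P[_ /uK' H _]; apply: le_trans (H s) _; rewrite lerDr.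
- by move=> x s v; rewrite !lt_min => /andP[xr _]; exact: du.
- by move=> x s v; rewrite !lt_min => /and3P[_ xr _]; exact: du'.
- by rewrite ua ua'.
- by move=> t; rewrite !lt_min => /and3P[_ _ tr]; exact: xiE''.
Unshelve. all: by end_near. Qed.

End WeierstrassUniqueness.

(** * The symbol, its rank, and the characteristic directions *)

Section WeierstrassSymbol.
Local Open Scope classical_set_scope.
Local Open Scope ring_scope.
Context {R : realType}.
Implicit Types (z : 'rV[R]_(2 + 4 + 8)) (X : 'rV[R]_2).

Lemma derive_affine (V : normedModType R) (f : V -> R) (z v : V) (k : R) :
  (forall h : R, f (h *: v + z) = f z + h * k) -> 'D_v f z = k.
Proof.
move=> fk; have [_ //] : is_derive z v f k.
apply: (@is_derive_quadratic _ _ _ _ _ _ 0 1) => // h _.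
by rewrite fk addrAC addrK subrr normr0 mul0r.
Qed.

Lemma graph_pointK z : z = graph_point (xpart z) (xipart z) (upart z).
Proof. by rewrite /graph_point /xpart /xipart /upart !hsubmxK. Qed.

Lemma wform_affine (U XI d : nat -> R) (h : R) (s : nat) :
  let c := wform U XI s in let c' := wform U (fun k => XI k + d k) s in
  wform U (fun k => XI k + h * d k) s = (c.1 + h * (c'.1 - c.1), c.2 + h * (c'.2 - c.2)).
Proof.
by case: s => [|[|[|[|[|[|[|[|s]]]]]]]]; rewrite /wform /= ?nth_nil /=; congr pair; ring.
Qed.

(** As [wform] is affine in xi, [p] being free of xi, this difference for a unit increment is
    exactly the pair of partial derivatives with respect to xi^r. *)
Definition dwform z (s : 'I_8) (r : 'I_4) : R * R :=
  let U k := upart z 0 (inord k) in let XI k := xipart z 0 (inord k) in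
  let c' := wform U (fun k => XI k + (inord k == r)%:R) s in
  (c'.1 - (wform U XI s).1, c'.2 - (wform U XI s).2).

Lemma symbol_weierstrass z X s r :
  symbol (@weierstrass R) z X s r = (dwform z s r).1 * X 0 0 + (dwform z s r).2 * X 0 1.
Proof.
rewrite mxE big_ord2.
pose x := xpart z; pose xi := xipart z; pose u := upart z.
have E (h : R) mu : weierstrass (h *: graph_point 0 (delta_mx 0 r) 0 + z) s mu =
    let c := wform (fun k => u 0 (inord k)) (fun k => xi 0 (inord k) + h * (inord k == r)%:R) s in
    if mu == 0 then c.1 else c.2.
  have -> : h *: graph_point 0 (delta_mx 0 r) 0 + z = graph_point x (xi + h *: delta_mx 0 r) u.
    rewrite {1}(graph_pointK z) /graph_point !scale_row_mx !add_row_mx !scaler0 !add0r.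
    by rewrite [_ + xipart z]addrC.
  rewrite weierstrassE; suff -> : (fun k => (xi + h *: delta_mx 0 r) 0 (inord k)) =
    (fun k => xi 0 (inord k) + h * (inord k == r)%:R) by [].
  by apply/funext => k; rewrite !mxE eqxx.
have E0 mu : weierstrass z s mu =
    let c := wform (fun k => u 0 (inord k)) (fun k => xi 0 (inord k)) s in
    if mu == 0 then c.1 else c.2.
  by rewrite {1}(graph_pointK z) weierstrassE.
congr (_ * _ + _ * _); apply: derive_affine => h; rewrite E E0 /= wform_affine //.
Qed.

Lemma dwform_low z (s : 'I_8) r : (s < 4)%N ->
  dwform z s r = if d2_prescribed s then ((s == r :> nat)%:R, 0) else (0, (s == r :> nat)%:R).
Proof.
move=> s4; rewrite /dwform !wform_low //.
have -> : (inord s == r) = (s == r :> nat) by rewrite -val_eqE /= inordK.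
by case: ifP => _ /=; rewrite subrr addrAC subrr add0r.
Qed.

(** xi^1 enters through [Pbar] and directly, always in coefficients of dx^1. Hence the first column
    of the symbol is a multiple of X^1. *)
Lemma dwform_col0 z s : (dwform z s 0).2 = 0.
Proof.
have nz k : (0 < k < 4)%N -> (inord k == 0 :> 'I_4) = false.
  by case/andP=> k0 k4; rewrite -val_eqE /= inordK //; case: k k0 k4.
rewrite /dwform /=; apply/eqP; rewrite subr_eq0; apply/eqP.
case: s => -[|[|[|[|[|[|[|[|s]]]]]]]] s8; rewrite /wform //= ?nth_nil //=;
  rewrite ?nz //= ?mulr0n ?addr0 //.
Qed.

(** xi^2 enters through [P] and directly, always in coefficients of dx^2. Hence the second column of
    the symbol is a multiple of X^2. *)
Lemma dwform_col1 z s : (dwform z s 1).1 = 0.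
Proof.
have nz k : (k < 4)%N -> k != 1%N -> (inord k == 1 :> 'I_4) = false.
  by move=> k4 k1; rewrite -val_eqE /= inordK // (negbTE k1).
rewrite /dwform /=; apply/eqP; rewrite subr_eq0; apply/eqP.
case: s => -[|[|[|[|[|[|[|[|s]]]]]]]] s8; rewrite /wform //= ?nth_nil //=;
  rewrite ?nz //= ?mulr0n ?addr0 //.
Qed.

(** In the direction (1, 1) the first four rows of the symbol form the identity matrix. *)
Lemma rank_symbol_max z : \rank (symbol (@weierstrass R) z (const_mx 1)) = 4.
Proof.
apply/eqP; rewrite eqn_leq rank_leq_col /=.
pose f (i : 'I_4) : 'I_8 := widen_ord (isT : (4 <= 8)%N) i.
have <- : \rank (rowsub f (symbol (@weierstrass R) z (const_mx 1))) = 4.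
  rewrite -[RHS](mxrank1 R 4); congr (\rank _); apply/matrixP => i r.
  rewrite mxE symbol_weierstrass !mxE !mulr1 dwform_low //=.
  by case: ifP => _ /=; rewrite ?addr0 ?add0r.
by rewrite rowsubE mxrankM_maxr.
Qed.

Lemma char1_weierstrass z : char1 (@weierstrass R) z = 4.
Proof.
apply/eqP; rewrite eqn_leq; apply/andP; split.
  by apply/bigmax_leqP => k _; rewrite -ltnS.
apply: (@leq_bigmax_cond _
  (fun k : 'I_5 => `[< exists X, \rank (symbol (@weierstrass R) z X) = k >])
  (fun k : 'I_5 => nat_of_ord k) ord_max).
by apply/asboolP; exists (const_mx 1); rewrite rank_symbol_max.
Qed.

Lemma symbol_col_neq0 z X r : \rank (symbol (@weierstrass R) z X) = 4 ->
  exists s, symbol (@weierstrass R) z X s r != 0.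
Proof.
move=> r4; apply: contrapT => H.
have S0 s : symbol (@weierstrass R) z X s r = 0.
  by apply/eqP; apply: contrapT => /negP nz; apply: H; exists s.
have /row_fullP[B BS] : row_full (symbol (@weierstrass R) z X) by apply/eqP.
have := congr1 (fun M : 'M[R]_4 => M r r) BS; rewrite !mxE eqxx big1 => [/eqP|s _].
  by rewrite eq_sym oner_eq0.
by rewrite S0 mulr0.
Qed.

(** A symbol of full column rank has no zero column, whereas X^1 = 0 kills the first one and X^2 = 0
    the second. *)
Lemma noncharacteristic z X : \rank (symbol (@weierstrass R) z X) = char1 (@weierstrass R) z ->
  X 0 0 != 0 /\ X 0 1 != 0.
Proof.
rewrite char1_weierstrass => r4; split.
  have [s] := symbol_col_neq0 0 r4; apply: contra_neq => X0.
  by rewrite symbol_weierstrass X0 dwform_col0 mulr0 mul0r addr0.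
have [s] := symbol_col_neq0 1 r4; apply: contra_neq => X1.
by rewrite symbol_weierstrass X1 dwform_col1 mulr0 mul0r addr0.
Qed.

End WeierstrassSymbol.

Theorem proposition1 (R : realType)
    (x0 : 'rV[R]_2) (xi0 : 'rV[R]_4) (u0 : 'rV[R]_8) :
  regular_point (@weierstrass R) (graph_point x0 xi0 u0) ->
  in_involution (@weierstrass R) (graph_point x0 xi0 u0) ->
  analytic_near (@weierstrass R) (graph_point x0 xi0 u0) ->
  general_analytic_solution (@weierstrass R) (graph_point x0 xi0 u0) /\
  depends_on_functions_of_one_variable (@weierstrass R) (graph_point x0 xi0 u0) 4.
Proof.
move=> _ _ _; split; last first.
  by split; rewrite /char2 char1_weierstrass.
near=> w; move=> X phi _ /noncharacteristic[X0 X1] aphi _; split.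
  exact: weierstrass_cauchy_existence.
by move=> _ xi u xi' u'; exact: weierstrass_cauchy_unique.
Unshelve. all: by end_near. Qed.
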